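(* There are absolute constants $c>0$ and $c_1,c_2\ge 1$ such that the following holds. Let $V\subseteq\mathbb{R}^{n_1\times\cdots\times n_d}$ be the set of tensors with CP rank at most $r$, where $n_i\geq 2$ for each $i$. Denote by $\overline{n}=\frac1d\sum_{i=1}^d n_i$ the average dimension. Then for any $t>0$ and $\varepsilon\in(0,2t]$, $$\log\mathcal{N}\big(V\cap t\cdot\mathcal{B}^{n_1\times\cdots\times n_d},\varepsilon\big)\;\leq\; rd\overline{n}\cdot\log(t/\varepsilon) + c\,rd\overline{n}\cdot\sum_{i=1}^d\log n_i .$$ If in fact $r\leq\min_i n_i$, then $$\log\mathcal{N}\big(V\cap t\cdot\mathcal{B}^{n_1\times\cdots\times n_d},\varepsilon\big)\;\leq\; rd\overline{n}\,\log(c_1 d t/\varepsilon) + c_2 d^2r^2\log r - dr^2\log(c_1).$$ Moreover, the bounds above also apply to $\log\mathcal{N}(\pi(V),\varepsilon)$ with $t=1$ and with $rd\overline{n}$ replaced by $rd\overline{n}-1$ (so $\varepsilon\in(0,2]$).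
   Context: A tensor $\mathcal{T}\in\mathbb{R}^{n_1\times\cdots\times n_d}$ has CP rank at most $r$ if there exist vectors $a_i^{(j)}\in\mathbb{R}^{n_i}$ ($i=1,\dots,d$, $j=1,\dots,r$) with $\mathcal{T}=\sum_{j=1}^r a_1^{(j)}\otimes\cdots\otimes a_d^{(j)}$. The tensor space carries the Frobenius (Euclidean) norm, and $\mathcal{B}^{n_1\times\cdots\times n_d}$ is its closed unit ball. $\pi(U)=\{x/\|x\|: x\in U, x\ne 0\}$ is the projection to the unit sphere. $\mathcal{N}(W,\varepsilon)$ is the minimal cardinality of a subset $S\subseteq W$ such that every $x\in W$ has some $y\in S$ with $\|x-y\|\le\varepsilon$. $\log$ is the natural logarithm.
   Formalization: The second bound for $\pi(V)$ is stated without the case $d=1$, $r=1$, $n_1=2$, where $\pi(V)$ is the unit circle and the bound would read $\log\mathcal N\le\log(1/\varepsilon)$, which is false for every $\varepsilon\in(0,2]$; $r\ge 1$ is assumed throughout. *)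

(* Defs.v *)
From HB Require Import structures.
From mathcomp Require Import all_boot all_order all_algebra.
From mathcomp Require Import all_classical all_reals all_analysis.
Set Implicit Arguments.
Unset Strict Implicit.
Unset Printing Implicit Defensive.
Import Order.TTheory GRing.Theory Num.Theory.
Local Open Scope classical_set_scope.
Local Open Scope ring_scope.

Definition mindex (d : nat) (n : 'I_d -> nat) : finType :=
  {dffun forall i : 'I_d, 'I_(n i)}.

Definition tensor (R : realType) (d : nat) (n : 'I_d -> nat) : lmodType R :=
  {ffun mindex n -> R}.

Definition outer (R : realType) (d : nat) (n : 'I_d -> nat)
    (a : forall i : 'I_d, 'rV[R]_(n i)) : tensor R n :=
  [ffun I : mindex n => \prod_(i < d) a i ord0 (I i)].

Definition cp_rank_le (R : realType) (d : nat) (n : 'I_d -> nat) (r : nat) :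
    set (tensor R n) :=
  [set T | exists a : 'I_r -> forall i : 'I_d, 'rV[R]_(n i),
             T = \sum_(j < r) outer (a j)].

Definition frobenius (R : realType) (d : nat) (n : 'I_d -> nat)
    (T : tensor R n) : R :=
  Num.sqrt (\sum_(I : mindex n) (T : {ffun mindex n -> R}) I ^+ 2).

Definition unit_ball (R : realType) (d : nat) (n : 'I_d -> nat) :
    set (tensor R n) :=
  [set T | frobenius T <= 1].

Arguments unit_ball R {d} n.
Arguments cp_rank_le R {d} n r.

Definition sphere_proj (R : realType) (d : nat) (n : 'I_d -> nat)
    (U : set (tensor R n)) : set (tensor R n) :=
  [set (frobenius T)^-1 *: T | T in [set T | U T /\ T != 0]].

Definition is_net (R : realType) (d : nat) (n : 'I_d -> nat)
    (W : set (tensor R n)) (eps : R) (S : set (tensor R n)) : Prop :=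
  S `<=` W /\
  forall x, W x -> exists y, S y /\ frobenius (x - y) <= eps.

(* Valued in the extended reals: it is +oo when W has no finite eps-net. *)
Definition covering_number (R : realType) (d : nat) (n : 'I_d -> nat)
    (W : set (tensor R n)) (eps : R) : \bar R :=
  ereal_inf [set (k%:R)%:E | k in
    [set k : nat | exists S : set (tensor R n), is_net W eps S /\ (S #= `I_k)%card]].

Definition avg_dim (R : realType) (d : nat) (n : 'I_d -> nat) : R :=
  d%:R^-1 * \sum_(i < d) (n i)%:R.

(* Main.v *)
Require Import Defs.
From HB Require Import structures.
From mathcomp Require Import all_boot all_order all_algebra.
From mathcomp Require Import all_classical all_reals all_analysis.
From mathcomp Require Import ring lra zify.
Import Order.TTheory GRing.Theory Num.Theory.
Local Open Scope classical_set_scope.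
Local Open Scope ring_scope.

(** A bounded tensor of CP rank at most r may only have decompositions with huge
    factors, so nets on the factors say nothing. The proof uses instead that the
    coordinates of T are polynomials, of degree at most 1 in each variable, in the
    D = r * (n_1 + ... + n_d) entries of the factors.

    The polynomial method (poly_packing). Let P be such a map on R^D, and let
    y_a = P(z_a) be points of norm at most t with mutual distances above eps, in a
    space of dimension N. Choose a polynomial q in one variable with q(0) = 1 and
    |q(s)| <= 1 / ((2m+1) sqrt s) on [0,1), of degree m of order t/eps: the quotient
    sin((2m+1)u) / ((2m+1) sin u) is such a polynomial in s = (sin u)^2. The functions
    F_b(z) = q(|P(z) - y_b|^2 / (8 t^2))^(2N) are polynomials in z of degree at most
    E = 4 m N in each variable, so they span a space of dimension at most (E+1)^D. On
    the other hand F_b(z_b) = 1, and F_b decays like (eps / distance)^(2N) away from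
    y_b, faster than the number of points in a ball of R^N grows. Hence the matrix
    F_b(z_a) is diagonally dominant, so invertible, and the number of points is at
    most (E+1)^D <= (34 N t/eps)^D. With N = n_1 ... n_d this is the first bound.

    The growth of the number of separated points in a ball is bounded for any
    seminorm by (1 + 3 rho/delta)^dim (packing_bound). No volume is needed: from M
    points one forms the M^L digit expansions sum_l th^l y_(a_l); they stay
    separated at scale th^L, while counting their rounded coordinates shows that
    there are at most C th^(- L dim) of them. Let L tend to infinity.

    The case r <= n_i (cp_ball_packing_tucker). The factors of T in mode i span a
    subspace of dimension at most r of R^(n_i). The r-dimensional subspaces have a
    net of C^(r n_i) (C/delta)^(r (n_i - r)) elements in operator norm (frame_net):
    first a coarse net, then, near each of its elements E, a chart whose coordinates
    are the linear maps from E to its orthogonal complement. Projecting every mode of T on the nearest subspace of the net,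
    with delta = eps/(4dt), moves T by at most eps/4. Tensors with the same subspaces
    become tensors of rank at most r in one space of dimension r^d with d r^2
    parameters, and the polynomial method there does not see the n_i.

    The sphere (sphere_packing). About 1/eps multiples of each point of a separated
    subset of the sphere form a separated subset of the ball, because V is a cone;
    so one power of 1/eps is gained on the bounds for the ball.

    Separated sets and nets are linked by maximality (lne_covering_number_le). *)

(** * Euclidean norms and packing in a seminorm *)

Definition enorm {R : realType} {J : finType} (f : J -> R) : R :=
  Num.sqrt (\sum_j f j ^+ 2).

Lemma sqr_enorm {R : realType} {J : finType} (f : J -> R) :
  enorm f ^+ 2 = \sum_j f j ^+ 2.
Proof. by rewrite sqr_sqrtr // sumr_ge0 // => j _; rewrite sqr_ge0. Qed.

Lemma enorm_ge0 {R : realType} {J : finType} (f : J -> R) : 0 <= enorm f.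
Proof. exact: sqrtr_ge0. Qed.

Lemma enorm_le {R : realType} {J : finType} (f : J -> R) (s : R) :
  0 <= s -> (enorm f <= s) = (\sum_j f j ^+ 2 <= s ^+ 2).
Proof. by move=> s0; rewrite -sqr_enorm ler_pXn2r // nnegrE ?enorm_ge0. Qed.

Lemma eq_enorm {R : realType} {J : finType} (f g : J -> R) :
  f =1 g -> enorm f = enorm g.
Proof. by move=> fg; congr Num.sqrt; apply: eq_bigr => j _; rewrite fg. Qed.

Lemma enormZ {R : realType} {J : finType} (a : R) (f : J -> R) :
  enorm (fun j => a * f j) = `|a| * enorm f.
Proof.
rewrite /enorm (eq_bigr (fun j => a ^+ 2 * f j ^+ 2)); last first.
  by move=> j _; rewrite exprMn.
by rewrite -mulr_sumr sqrtrM ?sqr_ge0 // sqrtr_sqr.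
Qed.

Lemma sum_cauchy_schwarz {R : realType} {J : finType} (f g : J -> R) :
  (\sum_j f j * g j) ^+ 2 <= (\sum_j f j ^+ 2) * (\sum_j g j ^+ 2).
Proof.
(* Lagrange's identity *)
have : 0 <= \sum_i \sum_j (f i * g j - f j * g i) ^+ 2.
  by apply: sumr_ge0 => i _; apply: sumr_ge0 => j _; rewrite sqr_ge0.
have -> : \sum_i \sum_j (f i * g j - f j * g i) ^+ 2 =
   \sum_i \sum_j (f i ^+ 2 * g j ^+ 2) + \sum_i \sum_j (g i ^+ 2 * f j ^+ 2)
    - (\sum_i \sum_j (f i * g i) * (f j * g j)) *+ 2.
  rewrite -sumrMnl -sumrN -!big_split /=; apply: eq_bigr => i _.
  rewrite -sumrMnl -sumrN -!big_split /=; apply: eq_bigr => j _.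
  by ring.
have E (u v : J -> R) : \sum_i \sum_j u i * v j = (\sum_i u i) * (\sum_j v j).
  by rewrite mulr_suml; apply: eq_bigr => i _; rewrite mulr_sumr.
rewrite !E [(\sum_i g i ^+ 2) * _]mulrC -expr2; lra.
Qed.

Lemma enormD {R : realType} {J : finType} (f g : J -> R) :
  enorm (fun j => f j + g j) <= enorm f + enorm g.
Proof.
rewrite enorm_le ?addr_ge0 ?enorm_ge0 //.
have -> : \sum_j (f j + g j) ^+ 2 =
    \sum_j f j ^+ 2 + \sum_j g j ^+ 2 + (\sum_j f j * g j) *+ 2.
  rewrite -sumrMnl -!big_split /=; apply: eq_bigr => j _; ring.
have : `|\sum_j f j * g j| <= enorm f * enorm g.
  rewrite -(@ler_pXn2r _ 2) ?nnegrE ?mulr_ge0 ?enorm_ge0 //.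
  by rewrite real_normK ?num_real // exprMn !sqr_enorm sum_cauchy_schwarz.
move=> /(le_trans (ler_norm _)); rewrite sqrrD !sqr_enorm; lra.
Qed.

Lemma enormB {R : realType} {J : finType} (f g : J -> R) :
  enorm (fun j => f j - g j) <= enorm f + enorm g.
Proof.
apply: le_trans (_ : enorm f + enorm (fun j => -1 * g j) <= _).
  rewrite [X in X <= _](@eq_enorm _ _ _ (fun j => f j + -1 * g j)).
    exact: enormD.
  by move=> j; rewrite mulN1r.
by rewrite enormZ normrN normr1 mul1r.
Qed.

Lemma enorm_distrC {R : realType} {J : finType} (f g : J -> R) :
  enorm (fun j => f j - g j) = enorm (fun j => g j - f j).
Proof. by congr Num.sqrt; apply: eq_bigr => j _; rewrite -sqrrN opprB. Qed.

(** K s x stands for: the seminorm of x is at most s. As a relation, it covers the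
    operator norm without taking a supremum. *)
Definition gauge {R : realType} {V : lmodType R} (K : R -> V -> Prop) : Prop :=
  [/\ K 0 0,
      forall s s' x y, K s x -> K s' y -> K (s + s') (x + y),
      forall a s x, K s x -> K (`|a| * s) (a *: x) &
      forall s s' x, s <= s' -> K s x -> K s' x].

(** Bounded coordinates give a bounded seminorm; no converse holds, since a gauge
    may vanish on a subspace. *)
Lemma gauge_comb {R : realType} {V : lmodType R} {K : R -> V -> Prop}
    {J : finType} (e : J -> V) (kap z : J -> R) (eta : R) :
  gauge K -> (forall j, 0 <= kap j) -> (forall j, K (kap j) (e j)) ->
  (forall j, `|z j| <= eta) ->
  K (eta * \sum_j kap j) (\sum_j z j *: e j).
Proof.
move=> [K0 KD KZ Kle] kap0 Ke zeta.
apply: (Kle (\sum_j `|z j| * kap j)).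
  by rewrite mulr_sumr; apply: ler_sum => j _; apply: ler_wpM2r.
by elim/big_rec2: _ => // j s x _ Ks; apply: KD => //; apply: KZ.
Qed.

Lemma bernoulli_inequality {R : realType} (q : R) (L : nat) :
  0 <= q -> 1 + L%:R * q <= (1 + q) ^+ L.
Proof.
move=> q0; elim: L => [|L IH]; first by rewrite mul0r addr0 expr0.
rewrite exprS; apply: le_trans (_ : (1 + q) * (1 + L%:R * q) <= _).
  rewrite mulrDl mul1r mulrDr mulr1 addrA -natr1 mulrDl mul1r.
  have : 0 <= q * (L%:R * q) by rewrite !mulr_ge0.
  lra.
by rewrite ler_wpM2l // addr_ge0.
Qed.

Lemma bounded_powers_le1 {R : realType} (q C : R) :
  0 <= q -> (forall L : nat, q ^+ L <= C) -> q <= 1.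
Proof.
move=> q0 qC; rewrite leNgt; apply/negP => q1.
have C0 : 0 <= C / (q - 1).
  by rewrite divr_ge0 ?(le_trans _ (qC 0%N)) // ?subr_ge0 ?ltW.
have := archi_boundP C0; set L := Num.Def.archi_bound _ => CL.
have := bernoulli_inequality (q - 1) L; rewrite subr_ge0 (ltW q1) => /(_ isT).
have -> : 1 + (q - 1) = q by ring.
move=> /le_trans/(_ (qC L)); move: CL; rewrite ltr_pdivrMr ?subr_gt0 //.
lra.
Qed.

Lemma truncn_eq_close {R : realType} (u v : R) :
  0 <= u -> 0 <= v -> Num.Def.truncn u = Num.Def.truncn v -> `|u - v| <= 1.
Proof.
move=> /truncn_itv/andP[u1 u2] /truncn_itv/andP[v1 v2] E.
rewrite -E in v1 v2; rewrite -natr1 in u2 v2.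
by rewrite ler_norml; apply/andP; split; lra.
Qed.

(** The bound that comparing volumes of balls would give, with 3 in place of 2. It is
    obtained by self-similarity: with th = delta/(delta+3), words of length L over
    A, read as digit expansions with digits y a in base th, are
    separated at scale th^L, because two digits differ by more than delta while the
    two tails, together, weigh at most 2 delta/3. Rounding coordinates bounds the
    number of words by C' th^(- L #|J|), and the constant disappears as L grows. *)
Lemma packing_bound {R : realType} {V : lmodType R} {K : R -> V -> Prop}
    {J A : finType} (e : J -> V) (y : A -> V) (delta : R) :
  gauge K -> 0 < delta ->
  (forall j, exists k, K k (e j)) ->
  (forall a, exists x : J -> R, y a = \sum_j x j *: e j) ->
  (forall a, K 1 (y a)) ->
  (forall a b, a != b -> ~ K delta (y a - y b)) ->
  #|A|%:R <= (1 + 3 / delta) ^+ #|J|.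
Proof.
move=> gK d0 /boolp.choice[k0 Kk0] /boolp.choice[x yE] K1 Ksep.
have [K0 KD KZ Kle] := gK.
(* th (1 + th + th^2 + ...) = delta/3 bounds the weight of a tail of digits *)
pose th := delta / (delta + 3).
have d3 : 0 < delta + 3 by lra.
have th0 : 0 < th by rewrite divr_gt0.
have th1 : 0 < 1 - th.
  by rewrite subr_gt0 ltr_pdivrMr // mul1r; lra.
have thE : 1 / (1 - th) = 1 + delta / 3.
  by rewrite /th; field; apply/andP; split; apply: lt0r_neq0; lra.
have thD : th * (1 + delta / 3) = delta / 3.
  by rewrite /th; field; rewrite gt_eqF.
pose Y := foldr (fun a z => y a + th *: z) 0.
pose X (w : seq A) j := foldr (fun a z => x a j + th * z) 0 w.
have YX w : Y w = \sum_j X w j *: e j.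
  elim: w => [|a w IH] /=; first by rewrite big1 // => j _; rewrite scale0r.
  rewrite IH yE scaler_sumr -big_split; apply: eq_bigr => j _.
  by rewrite /= scalerA -scalerDl.
have KY w : K (1 + delta / 3) (Y w).
  elim: w => [|a w IH] /=; first by apply: Kle K0; lra.
  apply: Kle (KD _ _ _ _ (K1 a) (KZ th _ _ IH)).
  by rewrite (ger0_norm (ltW th0)) thD.
pose C0 := \sum_a \sum_j `|x a j|.
have xC0 a j : `|x a j| <= C0.
  rewrite /C0 (bigD1 a) //= (bigD1 j) //= -addrA lerDl addr_ge0 //.
    by rewrite sumr_ge0.
  by rewrite sumr_ge0 // => ? _; rewrite sumr_ge0.
have C00 : 0 <= C0 by apply: sumr_ge0 => ? _; apply: sumr_ge0.
pose C := C0 * (1 + delta / 3).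
have C_ge0 : 0 <= C by rewrite mulr_ge0 //; lra.
have XC w j : `|X w j| <= C.
  elim: w => [|a w IH] /=; first by rewrite normr0.
  apply: le_trans (ler_normD _ _) _; rewrite normrM (ger0_norm (ltW th0)).
  apply: le_trans (lerD (xC0 a j) (ler_wpM2l (ltW th0) IH)) _.
  by rewrite /C mulrCA thD mulrDr mulr1.
have sep L w w' : size w = L -> size w' = L -> w != w' ->
    ~ K (th ^+ L * (delta / 3)) (Y w - Y w').
  elim: L w w' => [|L IH] [|a w] [|b w'] //= [sw] [sw'].
  rewrite eqseq_cons; have [<- /= ww'|ab _] := eqVneq a b.
    move=> /(KZ th^-1).
    rewrite opprD addrACA subrr add0r -scalerBr scalerA mulVf ?gt_eqF //.
    rewrite scale1r ger0_norm ?invr_ge0 ?ltW // exprS -mulrA mulKf ?gt_eqF //.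
    exact: IH.
  move=> Kd; apply: (Ksep a b ab).
  have -> : y a - y b = (y a + th *: Y w - (y b + th *: Y w')) +
      ((- th) *: Y w + th *: Y w').
    have -> : (- th) *: Y w + th *: Y w' = - (th *: Y w - th *: Y w').
      by rewrite opprB scaleNr addrC.
    by rewrite opprD addrACA addrK.
  apply: Kle (KD _ _ _ _ Kd (KD _ _ _ _ (KZ (- th) _ _ (KY w))
     (KZ th _ _ (KY w')))).
  rewrite normrN (ger0_norm (ltW th0)) thD.
  have : th ^+ L.+1 <= 1 by rewrite exprn_ile1 ?ltW //; lra.
  have : 0 <= th ^+ L.+1 by rewrite exprn_ge0 ?ltW.
  by move=> ? ?; nra.
pose kap j := `|k0 j|.
have kap0 j : 0 <= kap j by rewrite normr_ge0.
have Kkap j : K (kap j) (e j) by apply: Kle (Kk0 j); rewrite ler_norm.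
pose S := \sum_j kap j + 1.
have S0 : 0 < S by rewrite ltr_wpDl // sumr_ge0.
pose C' := 2 * C * (3 * S) / delta + 1.
suff main L : (#|A|%:R * th ^+ #|J|) ^+ L <= C' ^+ #|J|.
  have q0 : 0 <= #|A|%:R * th ^+ #|J|.
    by apply: mulr_ge0 => //; apply: exprn_ge0; apply: ltW.
  have := bounded_powers_le1 _ _ q0 main.
  rewrite -ler_pdivlMr ?exprn_gt0 // div1r -exprVn.
  suff -> : th^-1 = 1 + 3 / delta by [].
  by rewrite /th; field; rewrite !gt_eqF.
have thL : 0 < th ^+ L by rewrite exprn_gt0.
(* words with coordinates equal up to eta give points equal at scale th^L delta/3 *)
pose eta := th ^+ L * delta / (3 * S).
have eta0 : 0 < eta by rewrite divr_gt0 ?mulr_gt0.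
have u0 w j : 0 <= (X w j + C) / eta.
  apply: divr_ge0; last exact: ltW.
  by have := XC w j; rewrite ler_norml => /andP[]; lra.
have u1 w j : (X w j + C) / eta <= 2 * C / eta.
  rewrite ler_pM2r ?invr_gt0 //.
  by have := XC w j; rewrite ler_norml => /andP[]; lra.
pose B := Num.Def.truncn (2 * C / eta).
pose code (w : L.-tuple A) : {ffun J -> 'I_B.+1} :=
  [ffun j => inord (Num.Def.truncn ((X w j + C) / eta))].
have code_inj : injective code.
  move=> w w' /ffunP cE; apply/eqP/negP => /negP ww'.
  apply: (sep L w w'); rewrite ?size_tuple //.
  rewrite !YX -sumrB; under eq_bigr do rewrite -scalerBl.
  apply: (Kle (eta * \sum_j kap j)).
    have -> : th ^+ L * (delta / 3) = eta * S.
      by rewrite /eta; field; rewrite gt_eqF.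
    by rewrite ler_pM2l // /S; lra.
  apply: gauge_comb => // j.
  have : `|(X w j + C) / eta - (X w' j + C) / eta| <= 1.
    apply: truncn_eq_close; rewrite ?u0 //.
    have := congr1 val (cE j); rewrite !ffunE /= !inordK //.
      by rewrite ltnS; apply: le_truncn; apply: u1.
    by rewrite ltnS; apply: le_truncn; apply: u1.
  rewrite -mulrBl opprD addrACA subrr addr0 normrM (gtr0_norm (_ : 0 < eta^-1)).
    by rewrite ler_pdivrMr // mul1r.
  by rewrite invr_gt0.
have := leq_card _ code_inj; rewrite card_tuple card_ffun card_ord.
rewrite -(ler_nat R) !natrX => /le_trans h.
rewrite exprMn -exprM mulnC exprM -ler_pdivlMr ?exprn_gt0 //.
have Cd0 : 0 <= 2 * C * (3 * S) / delta.
  apply: divr_ge0; last exact: ltW.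
  by apply: mulr_ge0; apply: mulr_ge0 => //; exact: ltW.
apply: h; rewrite -expr_div_n lerXn2r ?nnegrE //.
  by apply: divr_ge0; [rewrite addr_ge0|exact: ltW].
have /andP[B1 _] : B%:R <= 2 * C / eta < B.+1%:R.
  by apply: truncn_itv; apply: divr_ge0; [exact: mulr_ge0|exact: ltW].
rewrite -natr1; apply: le_trans (lerD B1 (lexx _)) _.
rewrite ler_pdivlMr // mulrDl mul1r /C'.
have -> : 2 * C / eta * th ^+ L = 2 * C * (3 * S) / delta.
  by rewrite /eta; field; rewrite !gt_eqF.
by rewrite lerD2l exprn_ile1 ?ltW //; lra.
Qed.

(** * Maximal separated sets, diagonal dominance and polynomials *)

(** A separated family of largest size is a net. *)
Lemma maximal_packing {R : realType} {T : Type} (W : T -> Prop)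
    (far : T -> T -> Prop) (B : R) :
  (forall x y, far x y -> far y x) ->
  (forall (A : finType) (y : A -> T), (forall a, W (y a)) ->
     (forall a b, a != b -> far (y a) (y b)) -> #|A|%:R <= B) ->
  exists M : nat, exists y : 'I_M -> T,
    [/\ forall i, W (y i), forall i j, i != j -> far (y i) (y j) &
        forall x, W x -> exists i, ~ far x (y i)].
Proof.
move=> farC bnd.
pose P M := `[< exists y : 'I_M -> T, (forall i, W (y i)) /\
                  forall i j, i != j -> far (y i) (y j) >].
have PA (A : finType) (y : A -> T) : (forall a, W (y a)) ->
    (forall a b, a != b -> far (y a) (y b)) -> P #|A|.
  move=> Wy fy; apply/asboolP; exists (fun i => y (enum_val i)); split=> // i j.
  by move=> ij; apply: fy; rewrite (inj_eq enum_val_inj).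
have P0 : exists M, P M.
  exists 0%N; apply/asboolP; exists (fun i : 'I_0 => False_rect _ (notF (ltn_ord i))).
  by split; case.
have Pub M : P M -> (M <= Num.Def.truncn B)%N.
  move=> /asboolP[y [Wy fy]]; have := bnd _ _ Wy fy; rewrite card_ord => MB.
  by have := le_truncn MB; rewrite natrK.
case: (ex_maxnP P0 Pub) => M /asboolP[y [Wy fy]] maxM.
exists M, y; split => // x Wx; apply: contrapT => /forallNP near_x.
have {}near_x i : far x (y i) by apply: contrapT; exact: near_x.
have := PA (option 'I_M) (fun o => if o is Some i then y i else x).
rewrite card_option card_ord => H.
suff /maxM : P M.+1 by rewrite ltnn.
apply: H; first by case.
case=> [i|] [j|] ij /=.
- exact: fy.
- exact/farC/near_x.
- exact: near_x.
- by rewrite eqxx in ij.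
Qed.

(** If #|H| < #|A| some u <> 0 is killed by c, hence by F; the row of F at an
    index maximizing |u a| contradicts dominance. *)
Lemma diag_dominant_rank {R : realType} {A H : finType} (F : A -> A -> R)
    (phi : A -> H -> R) (c : H -> A -> R) :
  (forall a b, F a b = \sum_h phi a h * c h b) ->
  (forall a, \sum_(b | b != a) `|F a b| < F a a) -> (#|A| <= #|H|)%N.
Proof.
move=> FE dom; rewrite leqNgt; apply/negP => HA.
pose C := \matrix_(i < #|A|, k < #|H|) c (enum_val k) (enum_val i).
have : kermx C != 0.
  rewrite -mxrank_eq0 mxrank_ker -lt0n subn_gt0.
  exact: leq_ltn_trans (rank_leq_col _) HA.
case/rowV0Pn => v /sub_kermxP vC vn0.
pose u a := v ord0 (enum_rank a).
have uC h : \sum_b c h b * u b = 0.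
  have := congr1 (fun m : 'rV_ _ => m ord0 (enum_rank h)) vC; rewrite !mxE => E0.
  rewrite -[RHS]E0.
  rewrite (reindex_onto enum_val enum_rank) /=; last by move=> b _; rewrite enum_rankK.
  rewrite (eq_bigl xpredT); last by move=> i; rewrite enum_valK eqxx.
  by apply: eq_bigr => i _; rewrite !mxE enum_rankK /u enum_valK mulrC.
have Fu a : \sum_b F a b * u b = 0.
  transitivity (\sum_h phi a h * \sum_b c h b * u b).
    under eq_bigr do rewrite FE mulr_suml.
    rewrite exchange_big; apply: eq_bigr => h _; rewrite mulr_sumr.
    by apply: eq_bigr => b _; rewrite mulrA.
  by rewrite big1 // => h _; rewrite uC mulr0.
have [a0 ua0] : exists a0, u a0 != 0.
  apply: contrapT => /forallNP u0; move/eqP: vn0; apply.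
  apply/rowP => i; rewrite mxE; apply/eqP; rewrite -(negbK (_ == _)); apply/negP.
  by move=> h; apply: (u0 (enum_val i)); rewrite /u enum_valK.
case: (arg_maxP (fun a => `|u a|) (erefl (xpredT a0))) => a _ amax.
have ua : 0 < `|u a| by apply: lt_le_trans (amax a0 isT); rewrite normr_gt0.
have := Fu a; rewrite (bigD1 a) //= => /eqP; rewrite addr_eq0 => /eqP E.
have : F a a * `|u a| <= (\sum_(b | b != a) `|F a b|) * `|u a|.
  have Fa0 : 0 <= F a a by apply: le_trans (ltW (dom a)); apply: sumr_ge0.
  rewrite -{1}(ger0_norm Fa0) -normrM E normrN mulr_suml.
  apply: le_trans (ler_norm_sum _ _ _) _; apply: ler_sum => b _.
  by rewrite normrM; apply: ler_wpM2l => //; exact: amax.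
by rewrite ler_pM2r // leNgt dom.
Qed.

(** Consecutive terms of the sequence sin((2m+1)u)/sin u, as polynomials in
    s = (sin u)^2: these quotients satisfy the recurrence W_(m+2) = 2 cos(2u) W_(m+1) - W_m,
    and cos(2u) = 1 - 2s. *)
Fixpoint fejer_pair {R : realType} (m : nat) (s : R) : R * R :=
  if m is m'.+1 then
    let uv := fejer_pair m' s in (uv.2, (2 - 4 * s) * uv.2 - uv.1)
  else (1, 3 - 4 * s).

Definition fejer {R : realType} (m : nat) (s : R) : R := (fejer_pair m s).1.

Lemma fejer0 {R : realType} (m : nat) : fejer m (0 : R) = (2 * m + 1)%:R.
Proof.
suff : fejer_pair m (0 : R) = ((2 * m + 1)%:R, (2 * m + 3)%:R).
  by rewrite /fejer => ->.
elim: m => [|m IH] /=; first by congr pair; ring.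
rewrite IH /=; congr pair; first by congr (_%:R); lia.
rewrite !natrD !natrM -(natr1 m); ring.
Qed.

(** This is |sin((2m+1)u)| <= 1, proved without trigonometry: the recurrence preserves
    the quadratic form v^2 + u^2 - (2 - 4s)uv, whose value is 4 - 4s; completing
    the square in v leaves 4(1-s) s u^2 <= 4(1-s). *)
Lemma fejer_decay {R : realType} (m : nat) (s : R) :
  0 <= s -> s < 1 -> s * fejer m s ^+ 2 <= 1.
Proof.
move=> s0 s1.
have inv : (fejer_pair m s).2 ^+ 2 + (fejer_pair m s).1 ^+ 2
   - (2 - 4 * s) * ((fejer_pair m s).1 * (fejer_pair m s).2) = 4 - 4 * s.
  by elim: m => [|m <-] /=; ring.
rewrite /fejer; move: inv; set u := _.1; set v := _.2 => inv.
have : (1 - s) * (s * u ^+ 2) <= (1 - s) * 1.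
  have := sqr_ge0 (v - (1 - 2 * s) * u).
  have -> : (v - (1 - 2 * s) * u) ^+ 2 =
     v ^+ 2 + u ^+ 2 - (2 - 4 * s) * (u * v) - 4 * ((1 - s) * (s * u ^+ 2)).
    by ring.
  rewrite inv; lra.
by rewrite ler_pM2l // subr_gt0.
Qed.

(** The degree is counted in each variable separately: multilinear maps then have
    degree 1 whatever the number d of modes, and the dimension is exactly
    (E+1)^#|I|. *)
Definition poly_degs_le {R : realType} {I : finType} (E : nat)
    (f : (I -> R) -> R) : Prop :=
  exists c : {ffun I -> 'I_E.+1} -> R,
    forall x, f x = \sum_e c e * \prod_i x i ^+ e i.

Lemma poly_degs_le_ext {R : realType} {I : finType} (E : nat)
    (f g : (I -> R) -> R) :
  f =1 g -> poly_degs_le E f -> poly_degs_le E g.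
Proof. by move=> fg [c cE]; exists c => x; rewrite -fg. Qed.

Lemma poly_degs_leM1 {R : realType} {I : finType} (E : nat) (e : I -> nat) :
  (forall i, e i <= E)%N ->
  poly_degs_le E (fun x : I -> R => \prod_i x i ^+ e i).
Proof.
move=> eE; pose e' : {ffun I -> 'I_E.+1} := [ffun i => inord (e i)].
exists (fun f => (f == e')%:R) => x.
rewrite (bigD1 e') //= eqxx mul1r [X in _ = _ + X]big1 ?addr0; last first.
  by move=> f /negbTE ->; rewrite mul0r.
by apply: eq_bigr => i _; rewrite ffunE inordK // ltnS.
Qed.

Lemma poly_degs_leD {R : realType} {I : finType} (E : nat)
    (f g : (I -> R) -> R) :
  poly_degs_le E f -> poly_degs_le E g -> poly_degs_le E (fun x => f x + g x).
Proof.
move=> [c cE] [c' cE']; exists (fun e => c e + c' e) => x.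
by rewrite cE cE' -big_split; apply: eq_bigr => e _; rewrite mulrDl.
Qed.

Lemma poly_degs_leZ {R : realType} {I : finType} (E : nat) (a : R)
    (f : (I -> R) -> R) :
  poly_degs_le E f -> poly_degs_le E (fun x => a * f x).
Proof.
move=> [c cE]; exists (fun e => a * c e) => x.
by rewrite cE mulr_sumr; apply: eq_bigr => e _; rewrite mulrA.
Qed.

Lemma poly_degs_le_sum {R : realType} {I H : finType} (E : nat)
    (f : H -> (I -> R) -> R) :
  (forall h, poly_degs_le E (f h)) -> poly_degs_le E (fun x => \sum_h f h x).
Proof.
move=> /boolp.choice[c cE]; exists (fun e => \sum_h c h e) => x.
rewrite (eq_bigr _ (fun h _ => cE h x)) exchange_big.
by apply: eq_bigr => e _; rewrite mulr_suml.
Qed.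

Lemma poly_degs_le_cst {R : realType} {I : finType} (E : nat) (a : R) :
  poly_degs_le E (fun _ : I -> R => a).
Proof.
apply: poly_degs_le_ext (poly_degs_leZ E a _ (poly_degs_leM1 E (fun=> 0%N) _)) => //.
by move=> x; rewrite big1 ?mulr1.
Qed.

Lemma poly_degs_leM {R : realType} {I : finType} (E F : nat)
    (f g : (I -> R) -> R) :
  poly_degs_le E f -> poly_degs_le F g ->
  poly_degs_le (E + F) (fun x => f x * g x).
Proof.
move=> [c cE] [c' cE'].
apply: (poly_degs_le_ext _ (fun x => \sum_e \sum_e'
  (c e * c' e') * \prod_i x i ^+ (e i + e' i))) => [x|].
  rewrite cE cE' mulr_suml; apply: eq_bigr => e _; rewrite mulr_sumr.
  apply: eq_bigr => e' _; rewrite mulrACA -big_split /=; congr (_ * _).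
  by apply: eq_bigr => i _; rewrite exprD.
apply: poly_degs_le_sum => e; apply: poly_degs_le_sum => e'.
apply: poly_degs_leZ; apply: poly_degs_leM1 => i.
by apply: leq_add; rewrite -ltnS.
Qed.

Lemma poly_degs_leX {R : realType} {I : finType} (E k : nat)
    (f : (I -> R) -> R) :
  poly_degs_le E f -> poly_degs_le (E * k) (fun x => f x ^+ k).
Proof.
move=> fE; elim: k => [|k IH]; first by rewrite muln0; exact: poly_degs_le_cst.
by rewrite mulnS; apply: poly_degs_le_ext (poly_degs_leM _ _ _ _ fE IH) => x;
  rewrite exprS.
Qed.

Lemma poly_degs_le_fejer {R : realType} {I : finType} (E m : nat)
    (f : (I -> R) -> R) :
  poly_degs_le E f -> poly_degs_le (E * m) (fun x => fejer m (f x)).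
Proof.
move=> fE.
have lin a b : poly_degs_le E (fun x => a - b * f x).
  apply: poly_degs_le_ext (poly_degs_leD _ _ _ (poly_degs_le_cst E a)
    (poly_degs_leZ _ (- b) _ fE)) => x; by rewrite mulNr.
suff [] : poly_degs_le (E * m) (fun x => (fejer_pair m (f x)).1) /\
          poly_degs_le (E * m.+1) (fun x => (fejer_pair m (f x)).2) by [].
elim: m => [|m [IH1 IH2]] /=.
  by rewrite muln0 muln1; split; [exact: poly_degs_le_cst|exact: lin].
split=> //.
have := poly_degs_leM _ _ _ _ (lin 2 4) IH2.
have -> : (E + E * m.+1 = E * m.+2)%N by rewrite [in RHS]mulnS.
move=> h1.
have h2 : poly_degs_le (E * m.+2) (fun x => (fejer_pair m (f x)).1).
  have := poly_degs_leM _ _ _ _ IH1 (poly_degs_le_cst (I := I) (E * 2) (1 : R)).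
  have -> : (E * m + E * 2 = E * m.+2)%N by rewrite -mulnDr addn2.
  by apply: poly_degs_le_ext => x; rewrite mulr1.
apply: poly_degs_le_ext (poly_degs_leD _ _ _ h1 (poly_degs_leZ _ (-1) _ h2)) => x.
by rewrite mulN1r.
Qed.

(** * Packing the image of a polynomial map *)

Lemma packing_bound_ball {R : realType} {V : lmodType R} {K : R -> V -> Prop}
    {J A : finType} (e : J -> V) (y : A -> V) (c : V) (rho delta : R) :
  gauge K -> 0 < rho -> 0 < delta ->
  (forall j, exists k, K k (e j)) ->
  (forall a, exists x : J -> R, y a - c = \sum_j x j *: e j) ->
  (forall a, K rho (y a - c)) ->
  (forall a b, a != b -> ~ K delta (y a - y b)) ->
  #|A|%:R <= (1 + 3 * rho / delta) ^+ #|J|.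
Proof.
move=> [K0 KD KZ Kle] r0 d0 Ke yE Ky Ksep.
have -> : 3 * rho / delta = 3 / (delta / rho) by field; rewrite !gt_eqF.
apply: (@packing_bound _ _ (fun s x => K (rho * s) x) _ _ e (fun a => y a - c)).
- split.
  + by rewrite mulr0.
  + by move=> s s' x x'; rewrite mulrDr; exact: KD.
  + by move=> a s x; rewrite mulrCA; exact: KZ.
  + by move=> s s' x ss'; apply: Kle; rewrite ler_pM2l.
- by rewrite divr_gt0.
- move=> j; have [k Kk] := Ke j; exists (k / rho).
  by rewrite mulrC divfK // gt_eqF.
- exact: yE.
- by move=> a; rewrite mulr1.
- move=> a b ab; rewrite opprB addrA subrK mulrC divfK ?gt_eqF //.
  exact: Ksep.
Qed.

Lemma gauge_enorm {R : realType} {X : finType} :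
  gauge (fun (s : R) (v : {ffun X -> R}) => enorm v <= s).
Proof.
split.
- by rewrite enorm_le // expr0n /= big1 // => j _; rewrite ffunE expr0n.
- move=> s s' x y xs ys.
  apply: le_trans (_ : enorm x + enorm y <= _); last exact: lerD.
  by rewrite (@eq_enorm _ _ _ (fun j => x j + y j)) ?enormD // => j; rewrite ffunE.
- move=> a s x xs; rewrite (@eq_enorm _ _ _ (fun j => a * x j)).
    by rewrite enormZ ler_wpM2l.
  by move=> j; rewrite ffunE.
- by move=> s s' x ss' /le_trans; apply.
Qed.

Lemma sum_half_powers {R : realType} (L : nat) :
  \sum_(l < L) (7 / 16 * 2^-1 ^+ l : R) < 1.
Proof.
suff -> : \sum_(l < L) (7 / 16 * 2^-1 ^+ l : R) = 7 / 8 * (1 - 2^-1 ^+ L).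
  have : 0 < (2^-1 : R) ^+ L by rewrite exprn_gt0.
  lra.
elim: L => [|L IH]; first by rewrite big_ord0 expr0 subrr mulr0.
by rewrite big_ord_recr /= IH exprS; field.
Qed.

Lemma dyadic_shell {R : realType} (u : R) (L : nat) :
  1 < u -> u <= 2 ^+ L -> exists l : 'I_L, 2 ^+ l <= u <= 2 ^+ l.+1.
Proof.
move=> u1 uL; have ex : exists l, u <= 2 ^+ l by exists L.
case: (ex_minnP ex) => l ul lmin.
case: l ul lmin => [|l] ul lmin; first by rewrite expr0 leNgt u1 in ul.
exists (Ordinal (lmin _ uL)); rewrite /= ul andbT leNgt; apply/negP => lt.
by have := lmin _ (ltW lt); rewrite ltnn.
Qed.

(** The points at distance at most 2^(l+1) eps from y a number at most (7 * 2^l)^N,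
    where N = #|J|, and each contributes at most (4 * 2^l)^(-2N) when its distance
    is at least 2^l eps; the shells sum to less than 1. *)
Lemma separated_inverse_sum {R : realType} {X J A : finType}
    (e : J -> {ffun X -> R}) (y : A -> {ffun X -> R}) (t eps : R) (a : A) :
  0 < eps -> (0 < #|J|)%N ->
  (forall b, exists x : J -> R, y b = \sum_j x j *: e j) ->
  (forall b, enorm (y b) <= t) ->
  (forall b c, b != c -> eps < enorm (y b - y c)) ->
  \sum_(b | b != a) ((eps / (4 * enorm (y b - y a))) ^+ 2) ^+ #|J| < 1.
Proof.
move=> eps0 J0 yE yt sep; set N := #|J|.
pose u b := enorm (y b - y a) / eps.
have u1 b : b != a -> 1 < u b by move=> /sep; rewrite ltr_pdivlMr // mul1r.
(* all distances are below 2^L eps *)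
pose L := Num.Def.archi_bound (2 * t / eps).
have ut b : u b <= 2 * t / eps.
  rewrite ler_pM2r ?invr_gt0 // mulr_natl mulr2n.
  apply: le_trans (lerD (yt b) (yt a)).
  rewrite (@eq_enorm _ _ _ (fun x => y b x - y a x)); first exact: enormB.
  by move=> x; rewrite !ffunE.
have t0 : 0 <= t by apply: le_trans (yt a); exact: enorm_ge0.
have uL b : u b <= 2 ^+ L.
  apply: le_trans (ut b) _; apply: le_trans (ltW (archi_boundP _)) _.
    by apply: divr_ge0; [apply: mulr_ge0|apply: ltW].
  by rewrite -natrX ler_nat ltnW // ltn_expl.
pose w l : R := ((4 * 2 ^+ l)^-1 ^+ 2) ^+ N.
have w0 l : 0 <= w l by rewrite exprn_ge0 // sqr_ge0.
apply: (@le_lt_trans _ _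
  (\sum_(b | b != a) \sum_(l < L | u b <= 2 ^+ l.+1) w l)).
  apply: ler_sum => b ba.
  have [l /andP[lu ul]] := dyadic_shell (u b) L (u1 b ba) (uL b).
  rewrite (bigD1 l) //=; apply: ler_wpDr; first by rewrite sumr_ge0.
  have e0 : 0 < enorm (y b - y a) by apply: lt_trans (sep b a ba).
  have l0 : 0 < (2 : R) ^+ l by rewrite exprn_gt0.
  rewrite /w lerXn2r ?nnegrE ?sqr_ge0 // lerXn2r ?nnegrE //.
  - by apply: divr_ge0; [exact: ltW|rewrite mulr_ge0 // ltW].
  - rewrite ler_pdivrMr ?mulr_gt0 // mulrC ler_pdivlMr ?mulr_gt0 //.
    by move: lu; rewrite ler_pdivlMr // mulrC mulrCA ler_pM2l.
have count (l : nat) : #|[pred b | u b <= 2 ^+ l.+1]|%:R <= (7 * 2 ^+ l) ^+ N :> R.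
  have l1 : 1 <= (2 : R) ^+ l by rewrite exprn_ege1 // ler1n.
  pose rho : R := 2 ^+ l.+1 * eps.
  have rho0 : 0 < rho by rewrite mulr_gt0 ?exprn_gt0.
  rewrite -(card_sig [pred b | u b <= 2 ^+ l.+1]).
  apply: le_trans (_ : (1 + 3 * rho / eps) ^+ N <= _).
    apply: (@packing_bound_ball _ _ _ _ _ e (fun b => y (val b)) (y a) _ _ gauge_enorm) => //.
    - by move=> j; exists (enorm (e j)).
    - move=> b; have [x ->] := yE (val b); have [x' ->] := yE a.
      exists (fun j => x j - x' j); rewrite -sumrB.
      by apply: eq_bigr => j _; rewrite scalerBl.
    - by case=> b /=; rewrite /u ler_pdivrMr.
    - by move=> b c bc; apply/negP; rewrite -ltNge sep.
  rewrite lerXn2r ?nnegrE //.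
  - by rewrite addr_ge0 // divr_ge0 ?mulr_ge0 // ltW.
  - rewrite /rho mulrA mulfK ?gt_eqF // exprS; lra.
rewrite (exchange_big_dep xpredT) //=.
apply: le_lt_trans (sum_half_powers L); apply: ler_sum => l _.
apply: (@le_trans _ _ (\sum_(b | u b <= 2 ^+ l.+1) w l)).
  rewrite [X in _ <= X](bigID (fun b => b != a)) /=.
  apply: ler_wpDr; first by rewrite sumr_ge0.
  by rewrite le_eqVlt; apply/orP; left; apply/eqP; apply: eq_bigl => b; rewrite andbC.
rewrite sumr_const -[X in X <= _]mulr_natl.
apply: (@le_trans _ _ ((7 * 2 ^+ l) ^+ N * w l)).
  by apply: ler_wpM2r (w0 l) _ _ (count l).
have l0 : (2 : R) ^+ l != 0 by rewrite gt_eqF // exprn_gt0.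
have -> : (7 * 2 ^+ l) ^+ N * w l = (7 / 16 * 2^-1 ^+ l) ^+ N.
  rewrite /w -exprMn; congr (_ ^+ N); rewrite [2^-1 ^+ l]exprVn.
  by move: (2 ^+ l) l0 => p p0; field.
have b0 : 0 <= (7 / 16 * 2^-1 ^+ l : R) by rewrite mulr_ge0 // exprn_ge0.
have b1 : (7 / 16 * 2^-1 ^+ l : R) <= 1.
  have : (2^-1 : R) ^+ l <= 1 by apply: exprn_ile1; lra.
  lra.
by rewrite -[X in _ <= X]expr1 ler_wiXn2l.
Qed.

(** The points P(z a) need only span a space of dimension #|J|, possibly much smaller
    than the space {ffun X -> R} where the distances are measured. *)
Lemma poly_packing {R : realType} {I X J A : finType}
    (P : (I -> R) -> X -> R) (e : J -> {ffun X -> R}) (z : A -> I -> R)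
    (t eps : R) :
  0 < eps -> eps <= 2 * t -> (0 < #|J|)%N ->
  (forall x, poly_degs_le 1 (fun p => P p x)) ->
  (forall a, exists s : J -> R, [ffun x => P (z a) x] = \sum_j s j *: e j) ->
  (forall a, enorm (P (z a)) <= t) ->
  (forall a b, a != b -> eps < enorm (fun x => P (z a) x - P (z b) x)) ->
  #|A|%:R <= (34 * #|J|%:R * t / eps) ^+ #|I|.
Proof.
move=> eps0 et J0 Pdeg Pspan Pt sep; set N := #|J|.
have t0 : 0 < t by lra.
pose y a : {ffun X -> R} := [ffun x => P (z a) x].
pose q a b := \sum_x (P (z a) x - P (z b) x) ^+ 2.
have qE a b : q a b = enorm (y a - y b) ^+ 2.
  by rewrite sqr_enorm; apply: eq_bigr => x _; rewrite !ffunE.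
have yt a : enorm (y a) <= t.
  by rewrite (@eq_enorm _ _ _ (P (z a))) // => x; rewrite ffunE.
have ysep a b : a != b -> eps < enorm (y a - y b).
  move=> /sep /lt_le_trans; apply.
  by rewrite (@eq_enorm _ _ _ (y a - y b)) // => x; rewrite !ffunE.
(* 2m+1 >= 12 t/eps and 12^2 >= 16 * 8 give |F a b| <= (eps / (4 distance))^(2N);
   the scale 8 t^2 keeps the argument of fejer at most 1/2 *)
pose m := (Num.Def.truncn (6 * t / eps)).+1.
have te0 : 0 <= 6 * t / eps by apply: divr_ge0; [lra|exact: ltW].
have te1 : 1 <= 2 * t / eps by rewrite ler_pdivlMr ?mul1r.
have /andP[mle] := truncn_itv te0; rewrite -/m => mgt.
have {mle} mle : m%:R <= 8 * t / eps.
  rewrite (_ : m%:R = (Num.Def.truncn (6 * t / eps))%:R + 1); last by rewrite natr1.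
  apply: le_trans (lerD mle te1) _.
  by rewrite -mulrDl ler_pM2r ?invr_gt0 //; lra.
pose w : R := (2 * m + 1)%:R.
have w0 : 0 < w by rewrite ltr0n addn1.
have wge : 12 * t <= w * eps.
  rewrite -ler_pdivrMr // /w natrD natrM.
  have -> : 12 * t / eps = 2 * (6 * t / eps) by field; rewrite gt_eqF.
  lra.
pose F a b := (w^-1 * fejer m ((8 * t ^+ 2)^-1 * q a b)) ^+ (2 * N).
pose E := (2 * m * (2 * N))%N.
have Fpoly b : exists c : {ffun I -> 'I_E.+1} -> R, forall a,
    F a b = \sum_f c f * \prod_i z a i ^+ f i.
  have : poly_degs_le E (fun p : I -> R => (w^-1 * fejer m ((8 * t ^+ 2)^-1 *
      \sum_x (P p x - P (z b) x) ^+ 2)) ^+ (2 * N)).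
    apply: poly_degs_leX; apply: poly_degs_leZ; apply: poly_degs_le_fejer.
    apply: poly_degs_leZ; apply: poly_degs_le_sum => x.
    rewrite -[2%N]mul1n; apply: poly_degs_leX; apply: poly_degs_leD => //.
    exact: poly_degs_le_cst.
  by move=> [c cE]; exists c => a; rewrite -cE.
have [c cE] := boolp.choice Fpoly.
have F1 a : F a a = 1.
  rewrite /F (_ : q a a = 0); last first.
    by rewrite /q big1 // => x _; rewrite subrr expr0n.
  by rewrite mulr0 fejer0 mulVf ?gt_eqF // expr1n.
have Fab a b : b != a ->
    `|F a b| <= ((eps / (4 * enorm (y b - y a))) ^+ 2) ^+ N.
  move=> ba; have eb := ysep _ _ ba.
  have q0 : 0 < q a b.
    rewrite qE (_ : enorm (y a - y b) = enorm (y b - y a)).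
      by rewrite exprn_gt0 // (lt_trans eps0).
    rewrite (@eq_enorm _ _ _ (fun x => y a x - y b x)) => [|x]; last by rewrite !ffunE.
    by rewrite enorm_distrC; apply: eq_enorm => x; rewrite !ffunE.
  have qt : q a b <= 4 * t ^+ 2.
    rewrite qE -(_ : (2 * t) ^+ 2 = 4 * t ^+ 2); last by ring.
    rewrite lerXn2r ?nnegrE ?enorm_ge0 //; first by lra.
    rewrite (@eq_enorm _ _ _ (fun x => y a x - y b x)) => [|x]; last by rewrite !ffunE.
    apply: le_trans (enormB _ _) _; have := yt a; have := yt b; lra.
  have t20 : 0 < t ^+ 2 by rewrite exprn_gt0.
  rewrite /F exprM normrX lerXn2r ?nnegrE ?sqr_ge0 //.
  rewrite ger0_norm ?sqr_ge0 // exprMn.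
  have s1 : (8 * t ^+ 2)^-1 * q a b < 1 by rewrite mulrC ltr_pdivrMr; lra.
  have s0 : 0 <= (8 * t ^+ 2)^-1 * q a b.
    by apply: mulr_ge0; [rewrite invr_ge0; lra|exact: ltW].
  have := fejer_decay m _ s0 s1; set G := fejer m _ ^+ 2 => Gs.
  have qe : enorm (y b - y a) ^+ 2 = q a b.
    by rewrite sqr_enorm; apply: eq_bigr => x _; rewrite !ffunE -sqrrN opprB.
  rewrite expr_div_n exprMn qe exprVn mulrC ler_pdivrMr ?exprn_gt0 //.
  rewrite mulrAC ler_pdivlMr ?mulr_gt0 //.
  have Gq : G * q a b <= 8 * t ^+ 2.
    by move: Gs; rewrite -mulrA ler_pdivrMl ?mulr_gt0 // mulr1 mulrC.
  have w2 : (12 * t) ^+ 2 <= (w * eps) ^+ 2.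
    by rewrite lerXn2r ?nnegrE //; [lra|rewrite mulr_ge0 // ltW].
  rewrite -exprMn [eps * w]mulrC mulrCA; apply: le_trans w2.
  rewrite exprMn; lra.
have := diag_dominant_rank F 
  (fun a (f : {ffun I -> 'I_E.+1}) => \prod_i z a i ^+ f i) (fun f b => c b f).
have -> : #|{ffun I -> 'I_E.+1}| = (E.+1 ^ #|I|)%N by rewrite card_ffun card_ord.
move=> H; have {H} : (#|A| <= E.+1 ^ #|I|)%N.
  apply: H => [a b|a].
    by rewrite cE; apply: eq_bigr => f _; rewrite mulrC.
  rewrite F1; apply: le_lt_trans (separated_inverse_sum e y t eps a _ _ _ _ _) => //.
  by apply: ler_sum => b; exact: Fab.
rewrite -(ler_nat R) natrX => /le_trans; apply.
rewrite lerXn2r ?nnegrE //.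
  by apply: divr_ge0; [rewrite mulr_ge0 // ltW|exact: ltW].
have N1 : 1 <= N%:R :> R by rewrite ler1n.
rewrite (_ : E.+1%:R = E%:R + 1); last by rewrite natr1.
rewrite /E !natrM.
have -> : 34 * N%:R * t / eps = 2 * (8 * t / eps) * (2 * N%:R) + N%:R * (2 * t / eps).
  by field; rewrite gt_eqF.
apply: lerD; first by rewrite ler_wpM2r ?mulr_ge0 // ler_wpM2l.
by rewrite mulr_ege1.
Qed.

(** * Nets of subspaces *)

Definition rnorm {R : realType} {n : nat} (v : 'rV[R]_n) : R :=
  enorm (fun j => v ord0 j).

Lemma rnorm_ge0 {R : realType} {n : nat} (v : 'rV[R]_n) : 0 <= rnorm v.
Proof. exact: enorm_ge0. Qed.

Lemma rnorm_sum_sqr {R : realType} {n : nat} (v : 'rV[R]_n) :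
  rnorm v ^+ 2 = \sum_j v ord0 j ^+ 2.
Proof. exact: sqr_enorm. Qed.

Lemma sqr_rnorm {R : realType} {n : nat} (v : 'rV[R]_n) :
  rnorm v ^+ 2 = (v *m v^T) ord0 ord0.
Proof.
by rewrite rnorm_sum_sqr mxE; apply: eq_bigr => j _; rewrite mxE expr2.
Qed.

Lemma rnorm0 {R : realType} {n : nat} : rnorm (0 : 'rV[R]_n) = 0.
Proof. by apply/eqP; rewrite -sqrf_eq0 sqr_rnorm mul0mx mxE. Qed.

Lemma rnorm_eq0 {R : realType} {n : nat} (v : 'rV[R]_n) :
  rnorm v = 0 -> v = 0.
Proof.
move=> v0; apply/rowP => j; rewrite mxE; apply/eqP; rewrite -sqrf_eq0.
have : \sum_j v ord0 j ^+ 2 = 0 by rewrite -rnorm_sum_sqr v0 expr0n.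
move/eqP; rewrite psumr_eq0 => [/allP/(_ j)|i _]; last exact: sqr_ge0.
by rewrite mem_index_enum => /(_ isT).
Qed.

Lemma rnormD {R : realType} {n : nat} (u v : 'rV[R]_n) :
  rnorm (u + v) <= rnorm u + rnorm v.
Proof.
rewrite {1}/rnorm (@eq_enorm _ _ _ (fun j => u ord0 j + v ord0 j)).
  exact: enormD.
by move=> j; rewrite mxE.
Qed.

Lemma rnormZ {R : realType} {n : nat} (a : R) (v : 'rV[R]_n) :
  rnorm (a *: v) = `|a| * rnorm v.
Proof.
rewrite {1}/rnorm (@eq_enorm _ _ _ (fun j => a * v ord0 j)).
  exact: enormZ.
by move=> j; rewrite mxE.
Qed.

Lemma dot_le_rnorm {R : realType} {n : nat} (u v : 'rV[R]_n) :
  (u *m v^T) ord0 ord0 <= rnorm u * rnorm v.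
Proof.
apply: le_trans (ler_norm _) _.
rewrite -(@ler_pXn2r _ 2) ?nnegrE ?mulr_ge0 ?enorm_ge0 //.
rewrite real_normK ?num_real // exprMn !rnorm_sum_sqr mxE.
under eq_bigr do rewrite mxE.
exact: sum_cauchy_schwarz.
Qed.

Definition frame {R : realType} {r n : nat} (Q : 'M[R]_(r, n)) : Prop :=
  Q *m Q^T = 1%:M.

Lemma frame_isometry {R : realType} {r n : nat} (Q : 'M[R]_(r, n)) (w : 'rV_r) :
  frame Q -> rnorm (w *m Q) = rnorm w.
Proof.
move=> fQ; apply/eqP; rewrite -(@eqrXn2 _ 2) ?rnorm_ge0 // !sqr_rnorm.
by rewrite trmx_mul -mulmxA (mulmxA Q) fQ mul1mx.
Qed.

Lemma frame_coords_le {R : realType} {r n : nat} (Q : 'M[R]_(r, n)) (v : 'rV_n) :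
  frame Q -> rnorm (v *m Q^T) <= rnorm v.
Proof.
move=> fQ; have [->|vQ0] := eqVneq (rnorm (v *m Q^T)) 0; first exact: rnorm_ge0.
have : 0 < rnorm (v *m Q^T) by rewrite lt_def vQ0 rnorm_ge0.
move=> /ler_pM2l <-; rewrite -expr2 sqr_rnorm trmx_mul trmxK mulmxA.
by apply: le_trans (dot_le_rnorm _ _) _; rewrite frame_isometry.
Qed.

Lemma frame_residual_le {R : realType} {r n : nat} (Q : 'M[R]_(r, n))
    (v : 'rV_n) :
  frame Q -> rnorm (v *m (1%:M - Q^T *m Q)) <= rnorm v.
Proof.
move=> fQ; rewrite -(@ler_pXn2r _ 2) ?nnegrE ?rnorm_ge0 // !sqr_rnorm.
have -> : v *m (1%:M - Q^T *m Q) *m (v *m (1%:M - Q^T *m Q))^T =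
    v *m v^T - v *m Q^T *m (v *m Q^T)^T.
  have PT : (1%:M - Q^T *m Q)^T = 1%:M - Q^T *m Q.
    by apply/matrixP => i j; rewrite !mxE eq_sym; congr (_ - _);
      apply: eq_bigr => l _; rewrite !mxE mulrC.
  have PP : (1%:M - Q^T *m Q) *m (1%:M - Q^T *m Q) = 1%:M - Q^T *m Q.
    rewrite mulmxBl mul1mx mulmxBr mulmx1 -mulmxA (mulmxA Q) fQ mul1mx.
    by rewrite subrr subr0.
  rewrite !trmx_mul PT trmxK -mulmxA (mulmxA (1%:M - _)) PP mulmxBl mul1mx.
  by rewrite mulmxBr !mulmxA.
rewrite [X in X <= _]mxE [X in _ + X <= _]mxE gerDl oppr_le0.
by rewrite -sqr_rnorm sqr_ge0.
Qed.

Lemma orthogonal_unit_row {R : realType} {k n : nat} (Q : 'M[R]_(k, n)) :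
  (k < n)%N -> exists q : 'rV[R]_n, q *m q^T = 1%:M /\ q *m Q^T = 0.
Proof.
move=> kn; have : kermx Q^T != 0.
  rewrite -mxrank_eq0 mxrank_ker -lt0n subn_gt0.
  exact: leq_ltn_trans (rank_leq_col _) kn.
case/rowV0Pn => v /sub_kermxP vQ v0.
have rv0 : rnorm v != 0 by apply: contra_neq v0; exact: rnorm_eq0.
exists ((rnorm v)^-1 *: v); split; last by rewrite -scalemxAl vQ scaler0.
rewrite [LHS]mx11_scalar; congr (_%:M).
rewrite -sqr_rnorm rnormZ ger0_norm ?invr_ge0 ?rnorm_ge0 //.
by rewrite mulVf // expr1n.
Qed.

(** Gram-Schmidt: each new row contributes its normalized residual, or, when the
    residual vanishes, any unit vector orthogonal to the previous ones. *)
Lemma frame_containing_rows {R : realType} {k n : nat} (A : 'M[R]_(k, n)) :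
  (k <= n)%N -> exists Q : 'M[R]_(k, n), frame Q /\ A *m Q^T *m Q = A.
Proof.
elim: k A => [|k IH] A kn.
  exists 0; split; first by apply/matrixP; case.
  by apply/matrixP; case.
have [Q [fQ QA]] := IH (dsubmx (A : 'M[R]_(1 + k, n))) (ltnW kn).
pose a : 'rV_n := usubmx (A : 'M[R]_(1 + k, n)).
pose v := a - a *m Q^T *m Q.
have vQ : v *m Q^T = 0.
  by rewrite mulmxBl -!mulmxA fQ mulmx1 subrr.
have [q [qq qQ vq]] : exists q : 'rV[R]_n,
    [/\ q *m q^T = 1%:M, q *m Q^T = 0 & (v *m q^T) *m q = v].
  have [v0|v0] := eqVneq v 0.
    have [q [qq qQ]] := orthogonal_unit_row Q kn.
    by exists q; rewrite v0 !mul0mx.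
  have rv0 : rnorm v != 0 by apply: contra_neq v0; exact: rnorm_eq0.
  exists ((rnorm v)^-1 *: v).
  have vv : v *m v^T = (rnorm v ^+ 2)%:M by rewrite [LHS]mx11_scalar sqr_rnorm.
  have qT : ((rnorm v)^-1 *: v)^T = (rnorm v)^-1 *: v^T.
    by apply/matrixP => i j; rewrite !mxE.
  split.
  - rewrite qT -scalemxAl -scalemxAr vv scalerA scale_scalar_mx.
    by congr (_%:M); field.
  - by rewrite -scalemxAl vQ scaler0.
  - rewrite qT -scalemxAr -scalemxAr -scalemxAl vv mul_scalar_mx !scalerA.
    rewrite (_ : _ * _ = 1) ?scale1r //; by field.
have Qq : Q *m q^T = 0 by rewrite -[LHS]trmxK trmx_mul trmxK qQ trmx0.
exists (col_mx q Q : 'M[R]_(1 + k, n)); split.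
  change (col_mx q Q *m (col_mx q Q)^T = (1%:M : 'M[R]_(1 + k))).
  by rewrite tr_col_mx mul_col_row qq Qq qQ fQ -scalar_mx_block.
have AE : A = col_mx a (dsubmx (A : 'M[R]_(1 + k, n))) by rewrite vsubmxK.
change ((A : 'M[R]_(1 + k, n)) *m (col_mx q Q)^T *m col_mx q Q = A).
rewrite {1 2}AE tr_col_mx -!mulmxA mul_row_col mul_col_mx !mulmxDr !mulmxA.
congr col_mx.
  have -> : a *m q^T *m q = v.
    rewrite -vq; congr (_ *m _); rewrite /v mulmxBl -!mulmxA Qq !mulmx0.
    by rewrite subr0.
  by rewrite /v subrK.
by rewrite QA -{1}QA -!mulmxA (mulmxA Q) Qq mul0mx !mulmx0 add0r.
Qed.

(** The operator norm of A, acting on row vectors, is at most s. *)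
Definition opbound {R : realType} {r n : nat} (s : R) (A : 'M[R]_(r, n)) : Prop :=
  forall w : 'rV_r, rnorm (w *m A) <= s * rnorm w.

Lemma gauge_opbound {R : realType} {r n : nat} :
  gauge (@opbound R r n).
Proof.
split.
- by move=> w; rewrite mulmx0 rnorm0 mul0r.
- move=> s s' A B sA sB w; rewrite mulmxDr mulrDl.
  by apply: le_trans (rnormD _ _) _; apply: lerD.
- by move=> a s A sA w; rewrite -scalemxAr rnormZ -mulrA ler_wpM2l.
- by move=> s s' A ss' sA w; apply: le_trans (sA w) _; rewrite ler_wpM2r // rnorm_ge0.
Qed.

Lemma opbound_exists {R : realType} {r n : nat} (A : 'M[R]_(r, n)) :
  exists s, opbound s A.
Proof.
exists (Num.sqrt (\sum_j \sum_i A i j ^+ 2)) => w.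
rewrite enorm_le ?mulr_ge0 ?sqrtr_ge0 ?rnorm_ge0 //.
rewrite exprMn sqr_sqrtr; last by rewrite sumr_ge0 // => j _; rewrite sumr_ge0 // => i _; rewrite sqr_ge0.
rewrite mulr_suml; apply: ler_sum => j _; rewrite mxE mulrC.
by rewrite rnorm_sum_sqr; exact: sum_cauchy_schwarz.
Qed.

Lemma opboundN {R : realType} {r n : nat} (s : R) (A : 'M[R]_(r, n)) :
  opbound s A -> opbound s (- A).
Proof. by move=> sA w; rewrite mulmxN -scaleN1r rnormZ normrN1 mul1r. Qed.

Lemma frame_opbound1 {R : realType} {r n : nat} (Q : 'M[R]_(r, n)) :
  frame Q -> opbound 1 Q.
Proof. by move=> fQ w; rewrite frame_isometry // mul1r. Qed.

Lemma coarse_frame_net {R : realType} (r n : nat) :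
  exists M : nat, exists y : 'I_M -> 'M[R]_(r, n),
    [/\ M%:R <= 7 ^+ (r * n) :> R, forall i, frame (y i) &
        forall Q, frame Q -> exists i, opbound 2^-1 (Q - y i)].
Proof.
have [G0 GD GZ Gle] := @gauge_opbound R r n.
have bnd (A : finType) (y : A -> 'M[R]_(r, n)) : (forall a, frame (y a)) ->
    (forall a b, a != b -> ~ opbound 2^-1 (y a - y b)) ->
    #|A|%:R <= 7 ^+ (r * n) :> R.
  move=> fy sep.
  have := @packing_bound _ _ _ _ _ (fun p : 'I_r * 'I_n => delta_mx p.1 p.2)
    y 2^-1 gauge_opbound.
  rewrite card_prod !card_ord invrK (_ : 1 + 3 * 2 = 7); last by ring.
  apply => //.
  - by move=> p; exact: opbound_exists.
  - move=> a; exists (fun p => y a p.1 p.2).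
    by rewrite [LHS]matrix_sum_delta pair_big.
  - by move=> a; exact: frame_opbound1.
have farC (Q Q' : 'M[R]_(r, n)) : ~ opbound 2^-1 (Q - Q') -> ~ opbound 2^-1 (Q' - Q).
  by move=> h /opboundN; rewrite opprB.
have [M [y [fy sep net]]] := maximal_packing _ _ _ farC bnd.
exists M, y; split => //; first by have := bnd _ y fy sep; rewrite card_ord.
by move=> Q /net[i /contrapT Qi]; exists i.
Qed.

(** Among the matrices with the row space of Q, the one whose Q0-coordinates are
    the identity, when Q Q0^T is invertible. Its difference with Q0 is orthogonal
    to Q0, which leaves r (n - r) free parameters instead of r n. *)
Definition graph_chart {R : realType} {r n : nat} (Q0 Q : 'M[R]_(r, n)) :
  'M[R]_(r, n) := invmx (Q *m Q0^T) *m Q.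

(** u Q Q0^T differs from u by u (Q - Q0) Q0^T, of norm at most |u|/2. *)
Lemma near_frame_lower {R : realType} {r n : nat} (Q0 Q : 'M[R]_(r, n))
    (u : 'rV_r) :
  frame Q0 -> opbound 2^-1 (Q - Q0) -> rnorm u <= 2 * rnorm (u *m (Q *m Q0^T)).
Proof.
move=> fQ0 near.
have E : u *m (Q *m Q0^T) - u *m (Q - Q0) *m Q0^T = u.
  by rewrite mulmxBr mulmxBl -!mulmxA fQ0 mulmx1 opprB addrC subrK.
have : rnorm u <= rnorm (u *m (Q *m Q0^T)) + 2^-1 * rnorm u.
  rewrite -{1}E; apply: le_trans (rnormD _ _) _; rewrite lerD2l.
  rewrite -scaleN1r rnormZ normrN1 mul1r.
  exact: le_trans (frame_coords_le _ _ fQ0) (near u).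
lra.
Qed.

Lemma near_frame_unit {R : realType} {r n : nat} (Q0 Q : 'M[R]_(r, n)) :
  frame Q0 -> opbound 2^-1 (Q - Q0) -> Q *m Q0^T \in unitmx.
Proof.
move=> fQ0 near; rewrite -row_free_unit; apply: inj_row_free => u u0.
apply: rnorm_eq0; apply/eqP; rewrite eq_le rnorm_ge0 andbT.
by have := near_frame_lower _ _ u fQ0 near; rewrite u0 rnorm0 mulr0.
Qed.

Lemma graph_chart_offset {R : realType} {r n : nat} (Q0 Q : 'M[R]_(r, n)) :
  frame Q0 -> frame Q -> opbound 2^-1 (Q - Q0) ->
  (graph_chart Q0 Q - Q0) *m Q0^T = 0 /\ opbound 3 (graph_chart Q0 Q - Q0).
Proof.
move=> fQ0 fQ near; have Gu := near_frame_unit _ _ fQ0 near; split.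
  by rewrite mulmxBl fQ0 -mulmxA mulVmx // subrr.
have [_ GD _ _] := @gauge_opbound R r n.
rewrite (_ : 3 = 2 + 1); last by ring.
apply: GD; last by apply: opboundN; exact: frame_opbound1.
move=> w; rewrite mulmxA frame_isometry //.
by have := near_frame_lower _ _ (w *m invmx (Q *m Q0^T)) fQ0 near; rewrite mulmxKV.
Qed.

(** Two frames with close graph charts have close row spaces: w Q = (w G) Z with
    Z = graph_chart Q0 Q, G = Q Q0^T and |w G| <= |w|, and the projection killing the
    row space of y i also kills the chart of y i. *)
Lemma fine_frame_net {R : realType} (r n : nat) (Q0 : 'M[R]_(r, n)) (delta : R) :
  0 < delta -> frame Q0 ->
  exists M : nat, exists y : 'I_M -> 'M[R]_(r, n),
    [/\ M%:R <= (1 + 9 / delta) ^+ (r * (n - r)), forall i, frame (y i) &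
        forall Q, frame Q -> opbound 2^-1 (Q - Q0) ->
          exists i, opbound delta (Q *m (1%:M - (y i)^T *m y i))].
Proof.
move=> d0 fQ0.
have [G0 GD GZ Gle] := @gauge_opbound R r n.
pose Z := graph_chart Q0.
pose W Q := frame Q /\ opbound 2^-1 (Q - Q0).
have rk : \rank (kermx Q0^T) = (n - r)%N.
  rewrite mxrank_ker mxrank_tr; congr (_ - _)%N; apply/eqP.
  by apply/row_freeP; exists Q0^T.
pose B := row_base (kermx Q0^T).
have bnd (A : finType) (y : A -> 'M[R]_(r, n)) : (forall a, W (y a)) ->
    (forall a b, a != b -> ~ opbound delta (Z (y a) - Z (y b))) ->
    #|A|%:R <= (1 + 9 / delta) ^+ (r * (n - r)).
  move=> Wy sep; rewrite -rk.
  have := @packing_bound_ball _ _ _ _ _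
    (fun p : 'I_r * 'I_(\rank (kermx Q0^T)) => delta_mx p.1 p.2 *m B)
    (fun a => Z (y a)) Q0 3 delta gauge_opbound.
  rewrite card_prod !card_ord (_ : 3 * 3 = 9); last by ring.
  apply => //.
  - by move=> p; exact: opbound_exists.
  - move=> a; have [fy near] := Wy a.
    have : (Z (y a) - Q0 <= B)%MS.
      rewrite eq_row_base; apply/sub_kermxP.
      by have [] := graph_chart_offset _ _ fQ0 fy near.
    case/submxP => Y ->; exists (fun p => Y p.1 p.2).
    rewrite {1}[Y]matrix_sum_delta pair_big mulmx_suml.
    by apply: eq_bigr => p _; rewrite scalemxAl.
  - move=> a; have [fy near] := Wy a.
    by have [] := graph_chart_offset _ _ fQ0 fy near.
have farC (Q Q' : 'M[R]_(r, n)) : ~ opbound delta (Z Q - Z Q') ->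
    ~ opbound delta (Z Q' - Z Q).
  by move=> h /opboundN; rewrite opprB.
have [M [y [Wy sep net]]] := maximal_packing _ _ _ farC bnd.
exists M, y; split; first by have := bnd _ y Wy sep; rewrite card_ord.
  by move=> i; have [] := Wy i.
move=> Q fQ near; have [i /contrapT Qi] := net Q (conj fQ near); exists i => w.
have [fy neary] := Wy i.
have Gu := near_frame_unit _ _ fQ0 near.
have ZP : Z (y i) *m (1%:M - (y i)^T *m y i) = 0.
  by rewrite mulmxBr mulmx1 mulmxA -(mulmxA _ (y i)) fy mulmx1 subrr.
have -> : w *m (Q *m (1%:M - (y i)^T *m y i)) =
    w *m (Q *m Q0^T) *m (Z Q - Z (y i)) *m (1%:M - (y i)^T *m y i).
  rewrite -[in RHS]mulmxA mulmxBl ZP subr0 /Z /graph_chart !mulmxA.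
  by rewrite -!(mulmxA w) mulmxV // mul1mx.
apply: le_trans (frame_residual_le _ _ fy) _.
apply: le_trans (Qi _) _; apply: ler_wpM2l; first exact: ltW.
rewrite mulmxA; apply: le_trans (frame_coords_le _ _ fQ0) _.
by rewrite frame_isometry.
Qed.

(** A net of r-dimensional subspaces of R^n, each given by an orthonormal basis. The
    exponent r (n - r) of 1/delta is the dimension of the Grassmannian. *)
Lemma frame_net {R : realType} (r n : nat) (delta : R) :
  0 < delta ->
  exists A : finType, exists y : A -> 'M[R]_(r, n),
    [/\ #|A|%:R <= 7 ^+ (r * n) * (1 + 9 / delta) ^+ (r * (n - r)),
        forall i, frame (y i) &
        forall Q : 'M[R]_(r, n), frame Q ->
          exists i, opbound delta (Q *m (1%:M - (y i)^T *m y i))].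
Proof.
move=> d0; have [M [y [MB fy nety]]] := @coarse_frame_net R r n.
have H i : {m : nat & {z : 'I_m -> 'M[R]_(r, n) |
    [/\ m%:R <= (1 + 9 / delta) ^+ (r * (n - r)), forall j, frame (z j) &
        forall Q, frame Q -> opbound 2^-1 (Q - y i) ->
          exists j, opbound delta (Q *m (1%:M - (z j)^T *m z j))]}}.
  have /cid[m /cid[z zP]] := @fine_frame_net R r n (y i) delta d0 (fy i).
  by exists m, z.
pose m i := projT1 (H i); pose z i := sval (projT2 (H i)).
have mzP i := svalP (projT2 (H i)).
exists {i : 'I_M & 'I_(m i)}, (fun p : {i : 'I_M & 'I_(m i)} => z (tag p) (tagged p)); split.
- rewrite card_tagged sumnE big_map big_enum /= natr_sum.
  apply: le_trans (_ : M%:R * (1 + 9 / delta) ^+ (r * (n - r)) <= _).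
    rewrite -[M in X in _ <= X]card_ord mulr_natl -sumr_const.
    by apply: ler_sum => i _; rewrite card_ord; have [] := mzP i.
  by rewrite ler_wpM2r // exprn_ge0 // addr_ge0 // divr_ge0 // ltW.
- by move=> p; have [_ fz _] := mzP (tag p); exact: fz.
- move=> Q fQ; have [i /= near] := nety Q fQ.
  have [_ _ /(_ Q fQ near)[j Qj]] := mzP i.
  by exists (Tagged (fun i => 'I_(m i)) j).
Qed.

(** * Mode products and tensors of bounded CP rank *)

Definition upd {d : nat} {n : 'I_d -> nat} (I : mindex n) (k : 'I_d)
    (l : 'I_(n k)) : mindex n :=
  [ffun i => @eqtype.dfwith _ (fun i => 'I_(n i)) (fun i => I i) k l i].

Lemma upd_in {d : nat} {n : 'I_d -> nat} (I : mindex n) (k : 'I_d) (l : 'I_(n k)) :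
  upd I k l k = l.
Proof. by rewrite ffunE eqtype.dfwith_in. Qed.

Lemma upd_out {d : nat} {n : 'I_d -> nat} (I : mindex n) (k : 'I_d) (l : 'I_(n k))
    (i : 'I_d) :
  i != k -> upd I k l i = I i.
Proof. by move=> ik; rewrite ffunE eqtype.dfwith_out // eq_sym. Qed.

Lemma upd_upd {d : nat} {n : 'I_d -> nat} (I : mindex n) (k : 'I_d)
    (l m : 'I_(n k)) :
  upd (upd I k l) k m = upd I k m.
Proof.
apply/ffunP => i; have [->|ik] := eqVneq i k; first by rewrite !upd_in.
by rewrite !upd_out.
Qed.

Lemma upd_same {d : nat} {n : 'I_d -> nat} (I : mindex n) (k : 'I_d) :
  upd I k (I k) = I.
Proof.
apply/ffunP => i; have [->|ik] := eqVneq i k; first by rewrite upd_in.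
by rewrite upd_out.
Qed.

(** Summing over one line in direction k for every index I counts each index n k
    times. This isolates mode k without splitting the index type. *)
Lemma sum_upd {R : realType} {d : nat} {n : 'I_d -> nat} (k : 'I_d)
    (f : mindex n -> R) :
  \sum_I \sum_l f (upd I k l) = (n k)%:R * \sum_I f I.
Proof.
rewrite pair_big /=.
pose h (p : mindex n * 'I_(n k)) := (upd p.1 k p.2, p.1 k).
have hK : involutive h by case=> I l; rewrite /h /= upd_upd upd_same upd_in.
rewrite (reindex_inj (inv_inj hK)) /=.
under eq_bigr do rewrite upd_upd upd_same.
rewrite -(pair_big xpredT xpredT (fun I (_ : 'I_(n k)) => f I)) /= mulr_sumr.
by apply: eq_bigr => I _; rewrite sumr_const card_ord mulr_natl.
Qed.

Definition modeop {R : realType} {d : nat} {n : 'I_d -> nat} (k : 'I_d)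
    (L : 'M[R]_(n k)) (T : tensor R n) : tensor R n :=
  [ffun I => \sum_l (T : {ffun mindex n -> R}) (upd I k l) * L l (I k)].

(** The squared norm is a sum over the lines in direction k, and L acts on each
    of these lines separately. *)
Lemma modeop_le {R : realType} {d : nat} {n : 'I_d -> nat} (k : 'I_d)
    (L : 'M[R]_(n k)) (T : tensor R n) (s : R) :
  (0 < n k)%N -> 0 <= s -> opbound s L ->
  frobenius (modeop k L T) <= s * frobenius T.
Proof.
move=> nk s0 sL.
rewrite enorm_le ?mulr_ge0 ?enorm_ge0 // exprMn sqr_enorm.
have nk0 : 0 < (n k)%:R :> R by rewrite ltr0n.
rewrite -(ler_pM2l nk0) mulrCA -!sum_upd mulr_sumr; apply: ler_sum => I _.
pose v := \row_l (T : {ffun mindex n -> R}) (upd I k l).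
have : rnorm (v *m L) ^+ 2 <= (s * rnorm v) ^+ 2.
  by rewrite lerXn2r ?nnegrE ?mulr_ge0 ?rnorm_ge0.
rewrite exprMn !rnorm_sum_sqr.
have -> : \sum_j v ord0 j ^+ 2 = \sum_l (T : {ffun mindex n -> R}) (upd I k l) ^+ 2.
  by apply: eq_bigr => l _; rewrite mxE.
apply: le_trans; rewrite le_eqVlt; apply/orP; left; apply/eqP.
apply: eq_bigr => m _; rewrite ffunE upd_in mxE; congr (_ ^+ 2).
by apply: eq_bigr => l _; rewrite mxE upd_upd.
Qed.

Lemma modeop_sum {R : realType} {d : nat} {n : 'I_d -> nat} {H : finType}
    (k : 'I_d) (L : 'M[R]_(n k)) (T : H -> tensor R n) :
  modeop k L (\sum_h T h) = \sum_h modeop k L (T h).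
Proof.
apply/ffunP => I; rewrite ffunE [RHS]sum_ffunE.
under eq_bigr do rewrite sum_ffunE mulr_suml.
by rewrite exchange_big; apply: eq_bigr => h _; rewrite ffunE.
Qed.

Lemma modeopB {R : realType} {d : nat} {n : 'I_d -> nat}
    (k : 'I_d) (L M : 'M[R]_(n k)) (T : tensor R n) :
  modeop k (L - M) T = modeop k L T - modeop k M T.
Proof.
apply/ffunP => I; rewrite !ffunE -sumrB.
by apply: eq_bigr => l _; rewrite !mxE mulrBr.
Qed.

Lemma outer_ext {R : realType} {d : nat} {n : 'I_d -> nat}
    (a b : forall i, 'rV[R]_(n i)) :
  (forall i, a i = b i) -> outer a = outer b.
Proof.
by move=> ab; apply/ffunP => I; rewrite !ffunE; apply: eq_bigr => i _; rewrite ab.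
Qed.

Lemma modeop_outer {R : realType} {d : nat} {n : 'I_d -> nat}
    (k : 'I_d) (L : 'M[R]_(n k)) (a : forall i, 'rV[R]_(n i)) :
  modeop k L (outer a) = outer (eqtype.dfwith a (a k *m L)).
Proof.
apply/ffunP => I; rewrite !ffunE [RHS](bigD1 k) //= eqtype.dfwith_in mxE mulr_suml.
apply: eq_bigr => l _; rewrite ffunE (bigD1 k) //= upd_in mulrAC; congr (_ * _).
by apply: eq_bigr => i ik; rewrite upd_out // eqtype.dfwith_out // eq_sym.
Qed.

Definition cp_tensor {R : realType} {d r : nat} {n : 'I_d -> nat}
    (a : 'I_r -> forall i, 'rV[R]_(n i)) : tensor R n := \sum_j outer (a j).

Lemma cp_tensor_ext {R : realType} {d r : nat} {n : 'I_d -> nat}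
    (a b : 'I_r -> forall i, 'rV[R]_(n i)) :
  (forall j i, a j i = b j i) -> cp_tensor a = cp_tensor b.
Proof. by move=> ab; apply: eq_bigr => j _; exact: outer_ext. Qed.

Lemma modeop_cp {R : realType} {d r : nat} {n : 'I_d -> nat}
    (k : 'I_d) (L : 'M[R]_(n k)) (a : 'I_r -> forall i, 'rV[R]_(n i)) :
  modeop k L (cp_tensor a) = cp_tensor (fun j => eqtype.dfwith (a j) (a j k *m L)).
Proof. by rewrite modeop_sum; apply: eq_bigr => j _; rewrite modeop_outer. Qed.

Lemma frobeniusD {R : realType} {d : nat} {n : 'I_d -> nat} (S T : tensor R n) :
  frobenius (S + T) <= frobenius S + frobenius T.
Proof.
rewrite [X in X <= _](@eq_enorm _ _ _ (fun I => (S : {ffun _ -> _}) I + (T : {ffun _ -> _}) I)).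
  exact: enormD.
by move=> I; rewrite ffunE.
Qed.

Lemma frobeniusZ {R : realType} {d : nat} {n : 'I_d -> nat} (a : R) (T : tensor R n) :
  frobenius (a *: T) = `|a| * frobenius T.
Proof.
rewrite [LHS](@eq_enorm _ _ _ (fun I => a * (T : {ffun _ -> _}) I)).
  exact: enormZ.
by move=> I; rewrite ffunE.
Qed.

Lemma frobeniusBC {R : realType} {d : nat} {n : 'I_d -> nat} (S T : tensor R n) :
  frobenius (S - T) = frobenius (T - S).
Proof. by rewrite -(opprB T S) -[- (T - S)]scaleN1r frobeniusZ normrN1 mul1r. Qed.

Lemma frobenius_ge0 {R : realType} {d : nat} {n : 'I_d -> nat} (T : tensor R n) :
  0 <= frobenius T.
Proof. exact: enorm_ge0. Qed.

Definition project_modes {R : realType} {d r : nat} {n : 'I_d -> nat}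
    (P : forall i, 'M[R]_(n i)) (m : nat) (a : 'I_r -> forall i, 'rV[R]_(n i)) :
  'I_r -> forall i, 'rV[R]_(n i) :=
  fun j i => if (i < m)%N then a j i *m P i else a j i.

(** Telescoping over the modes: each projection is a contraction, and moves the
    tensor by at most delta times its norm, since in mode i it acts only on the
    row space of Q i. *)
Lemma project_modes_close {R : realType} {d r : nat} {n : 'I_d -> nat}
    (Q Y : forall i, 'M[R]_(r, n i)) (a : 'I_r -> forall i, 'rV[R]_(n i))
    (delta : R) (m : nat) :
  (forall i, 0 < n i)%N -> 0 <= delta ->
  (forall i, frame (Q i)) -> (forall i, frame (Y i)) ->
  (forall i, opbound delta (Q i *m (1%:M - (Y i)^T *m Y i))) ->
  (forall j i, a j i *m (Q i)^T *m Q i = a j i) -> (m <= d)%N ->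
  let b := project_modes (fun i => (Y i)^T *m Y i) m a in
  frobenius (cp_tensor b) <= frobenius (cp_tensor a) /\
  frobenius (cp_tensor a - cp_tensor b)
    <= m%:R * (delta * frobenius (cp_tensor a)).
Proof.
move=> n0 d0 fQ fY QY aQ; elim: m => [|m IH] md /=.
  rewrite (_ : cp_tensor _ = cp_tensor a); last exact: cp_tensor_ext.
  rewrite subrr -(scale0r (0 : tensor R n)) frobeniusZ normr0 !mul0r.
  by split.
have [IH1 IH2] := IH (ltnW md).
set b := project_modes _ m a in IH1 IH2; set c := project_modes _ _ _.
pose k := Ordinal md; pose E := (Q k)^T *m Q k; pose P := (Y k)^T *m Y k.
have cE : cp_tensor c = modeop k P (cp_tensor b).
  rewrite modeop_cp; apply: cp_tensor_ext => j i.
  have [->|ik] := eqVneq i k.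
    by rewrite eqtype.dfwith_in /c /b /project_modes /= ltnSn ltnn.
  rewrite eqtype.dfwith_out 1?eq_sym // /c /b /project_modes ltnS leq_eqVlt.
  have /negbTE -> // : nat_of_ord i != m.
  by apply: contraNneq ik => im; apply/eqP/val_inj.
have bE : cp_tensor b = modeop k E (cp_tensor b).
  rewrite modeop_cp; apply: cp_tensor_ext => j i.
  have [->|ik] := eqVneq i k; last by rewrite eqtype.dfwith_out // eq_sym.
  by rewrite eqtype.dfwith_in /b /project_modes /= ltnn /E mulmxA aQ.
have cE' : cp_tensor c = modeop k (E *m P) (cp_tensor b).
  rewrite cE modeop_cp [RHS]modeop_cp; apply: cp_tensor_ext => j i.
  have [->|ik] := eqVneq i k; last by rewrite !eqtype.dfwith_out // eq_sym.
  by rewrite !eqtype.dfwith_in /b /project_modes /= ltnn /E !mulmxA aQ.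
have bc : frobenius (cp_tensor b - cp_tensor c) <= delta * frobenius (cp_tensor b).
  rewrite {1}bE cE' -modeopB; apply: modeop_le => // w.
  have -> : w *m (E - E *m P) = (w *m (Q k)^T) *m (Q k *m (1%:M - P)).
    by rewrite !mulmxBr !mulmx1 !mulmxA.
  apply: le_trans (QY k _) _; apply: ler_wpM2l => //.
  exact: frame_coords_le.
split.
  apply: le_trans IH1; rewrite cE -[X in _ <= X]mul1r; apply: modeop_le => // w.
  rewrite mul1r mulmxA frame_isometry //; exact: frame_coords_le.
have -> : cp_tensor a - cp_tensor c =
    (cp_tensor a - cp_tensor b) + (cp_tensor b - cp_tensor c).
  by rewrite addrA subrK.
apply: le_trans (frobeniusD _ _) _.
rewrite -(natr1 m) mulrDl mul1r; apply: lerD => //.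
by apply: le_trans bc _; apply: ler_wpM2l.
Qed.

Lemma poly_degs_le_prod {R : realType} {I : finType} {d : nat} (g : 'I_d -> I) :
  injective g -> poly_degs_le 1 (fun z : I -> R => \prod_i z (g i)).
Proof.
move=> gi.
have := @poly_degs_leM1 R I 1 (fun p => #|[pred i | g i == p]|).
move=> H; apply: poly_degs_le_ext (H _) => [z|p].
  rewrite [RHS](partition_big g xpredT) //=; apply: eq_bigr => p _.
  rewrite -prodr_const; apply: eq_big => [i|i]; first by rewrite inE.
  by rewrite inE => /eqP ->.
apply/card_le1_eqP => i i'; rewrite !inE => /eqP <- /eqP; exact: gi.
Qed.

Lemma card_mindex {d : nat} (n : 'I_d -> nat) : #|mindex n| = (\prod_i n i)%N.
Proof.
rewrite card_dep_ffun foldrE big_map big_enum /=.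
by apply: eq_bigr => i _; rewrite card_ord.
Qed.

Lemma cp_ball_packing {R : realType} {d r : nat} {n : 'I_d -> nat} {A : finType}
    (y : A -> tensor R n) (t eps : R) :
  (forall i, 0 < n i)%N -> 0 < eps -> eps <= 2 * t ->
  (forall a, cp_rank_le R n r (y a)) ->
  (forall a, frobenius (y a) <= t) ->
  (forall a b, a != b -> eps < frobenius (y a - y b)) ->
  #|A|%:R <= (34 * (\prod_i n i)%N%:R * t / eps) ^+ (r * \sum_i n i).
Proof.
move=> n0 eps0 et yr yt sep.
pose al a := sval (cid (yr a)); have yE a := svalP (cid (yr a)).
pose I : finType := ('I_r * {i : 'I_d & 'I_(n i)})%type.
pose P (z : I -> R) (X : mindex n) :=
  \sum_(j < r) \prod_i z (j, Tagged (fun i => 'I_(n i)) (X i)).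
pose z a (p : I) := al a p.1 (tag p.2) ord0 (tagged p.2).
have Pz a X : P (z a) X = (y a : {ffun mindex n -> R}) X.
  rewrite yE sum_ffunE; apply: eq_bigr => j _; rewrite ffunE.
  by apply: eq_bigr.
have := @poly_packing R I (mindex n) (mindex n) A P
  (fun Y => [ffun X => (X == Y)%:R]) z t eps eps0 et.
have cI : #|I| = (r * \sum_i n i)%N.
  rewrite card_prod card_tagged card_ord sumnE big_map big_enum /=.
  by congr (_ * _)%N; apply: eq_bigr => i _; rewrite card_ord.
rewrite card_mindex cI; apply.
- by apply: prodn_gt0.
- move=> X; apply: poly_degs_le_sum => j; apply: poly_degs_le_prod => i i' E.
  exact: (congr1 (fun p : I => tag p.2) E).
- move=> a; exists (y a : {ffun mindex n -> R}); apply/ffunP => X.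
  rewrite ffunE Pz sum_ffunE (bigD1 X) //= !ffunE eqxx big1 => [|Y YX].
    by rewrite addr0 [RHS]mulr1.
  by rewrite !ffunE eq_sym (negbTE YX) [LHS]mulr0.
- move=> a; apply: le_trans (yt a); rewrite (@eq_enorm _ _ _ (y a : {ffun mindex n -> R})) //.
- move=> a b ab; apply: lt_le_trans (sep a b ab) _.
  rewrite [X in X <= _](@eq_enorm _ _ _ (fun X => P (z a) X - P (z b) X)) //.
  by move=> X; rewrite !ffunE !Pz.
Qed.

(** * Reduction to a small core *)

(** With the factors confined to the row spaces of fixed matrices Y i, the parameters
    are their d r^2 coordinates, and the tensors lie in the span of r^d products of
    rows. *)
Lemma cp_core_packing {R : realType} {d r : nat} {n : 'I_d -> nat} {A : finType}
    (Y : forall i, 'M[R]_(r, n i)) (b : A -> 'I_r -> 'I_d -> 'rV[R]_r)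
    (t eps : R) :
  let y a := cp_tensor (fun j i => b a j i *m Y i) in
  (0 < r)%N -> 0 < eps -> eps <= 2 * t ->
  (forall a, frobenius (y a) <= t) ->
  (forall a c, a != c -> eps < frobenius (y a - y c)) ->
  #|A|%:R <= (34 * r%:R ^+ d * t / eps) ^+ (d * (r * r)).
Proof.
move=> y r0 eps0 et yt sep.
pose I : finType := ('I_d * ('I_r * 'I_r))%type.
pose J : finType := {ffun 'I_d -> 'I_r}.
pose w (J : J) (X : mindex n) := \prod_i Y i (J i) (X i).
pose P (z : I -> R) (X : mindex n) :=
  \sum_(j < r) \sum_(f : J) w f X * \prod_i z (i, (j, f i)).
pose z a (p : I) := b a p.2.1 p.1 ord0 p.2.2.
have Pz a X : P (z a) X = (y a : {ffun mindex n -> R}) X.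
  rewrite sum_ffunE; apply: eq_bigr => j _; rewrite ffunE.
  under [RHS]eq_bigr do rewrite mxE.
  rewrite bigA_distr_bigA; apply: eq_bigr => f _.
  by rewrite -big_split; apply: eq_bigr => i _; rewrite mulrC.
have := @poly_packing R I (mindex n) J A P
  (fun f => [ffun X => w f X]) z t eps eps0 et.
rewrite !card_prod card_ffun !card_ord natrX.
apply.
- by rewrite expn_gt0 r0.
- move=> X; apply: poly_degs_le_sum => j; apply: poly_degs_le_sum => f.
  apply: poly_degs_leZ; apply: poly_degs_le_prod => i i' E.
  exact: (congr1 (fun p : I => p.1) E).
- move=> a; exists (fun f : J => \sum_j \prod_i z a (i, (j, f i))).
  apply/ffunP => X; rewrite ffunE sum_ffunE /P exchange_big.
  by apply: eq_bigr => f _; rewrite !ffunE -mulr_sumr mulrC.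
- move=> a; apply: le_trans (yt a).
  by rewrite (@eq_enorm _ _ _ (y a : {ffun mindex n -> R})).
- move=> a c ac; apply: lt_le_trans (sep a c ac) _.
  rewrite [X in X <= _](@eq_enorm _ _ _ (fun X => P (z a) X - P (z c) X)) //.
  by move=> X; rewrite !ffunE !Pz.
Qed.

Lemma card_le_fibers {R : realType} {A C : finType} (code : A -> C) (B : R) :
  (forall c, #|[pred a | code a == c]|%:R <= B) -> #|A|%:R <= #|C|%:R * B.
Proof.
move=> fib; rewrite -sum1_card natr_sum (partition_big code xpredT) //=.
rewrite mulr_natl -sumr_const; apply: ler_sum => c _.
by apply: le_trans (fib c); rewrite -natr_sum sum1_card.
Qed.

(** Pigeonhole on the subspaces of the nets nearest to the factors: inside a class, the
    projected tensors are still separated by eps/2. *)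
Lemma cp_ball_packing_tucker {R : realType} {d r : nat} {n : 'I_d -> nat}
    {A : finType} (y : A -> tensor R n) (t eps : R) :
  (0 < d)%N -> (0 < r)%N -> (forall i, r <= n i)%N -> 0 < eps -> eps <= 2 * t ->
  (forall a, cp_rank_le R n r (y a)) ->
  (forall a, frobenius (y a) <= t) ->
  (forall a b, a != b -> eps < frobenius (y a - y b)) ->
  #|A|%:R <= (266 * d%:R * t / eps) ^+ (\sum_i r * (n i - r)) *
             (476 * r%:R ^+ d * t / eps) ^+ (d * (r * r)).
Proof.
move=> d0 r0 rn eps0 et yr yt sep.
have t0 : 0 < t by lra.
have dR : 1 <= d%:R :> R by rewrite ler1n.
pose delta := eps / (4 * d%:R * t).
have dt0 : 0 < d%:R * t by rewrite mulr_gt0 // ltr0n.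
have delta0 : 0 < delta by rewrite divr_gt0 // -mulrA mulr_gt0.
have n0 i : (0 < n i)%N by exact: leq_trans (rn i).
have net i : {N : finType & {Y : N -> 'M[R]_(r, n i) |
    [/\ #|N|%:R <= 7 ^+ (r * n i) * (1 + 9 / delta) ^+ (r * (n i - r)),
        forall k, frame (Y k) &
        forall Q : 'M[R]_(r, n i), frame Q ->
          exists k, opbound delta (Q *m (1%:M - (Y k)^T *m Y k))]}}.
  by have /cid[N /cid[Y YP]] := frame_net r (n i) delta delta0; exists N, Y.
pose N i := projT1 (net i); pose Y i : N i -> _ := sval (projT2 (net i)).
have YP i := svalP (projT2 (net i)).
pose al a := sval (cid (yr a)); have yE a := svalP (cid (yr a)).
have Qex a i : {Q : 'M[R]_(r, n i) | frame Q /\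
    forall j, al a j i *m Q^T *m Q = al a j i}.
  have /cid[Q [fQ QA]] := frame_containing_rows (\matrix_j al a j i) (rn i).
  exists Q; split => // j.
  by have := congr1 (row j) QA; rewrite !row_mul rowK.
pose Q a i := sval (Qex a i).
have fQ a i : frame (Q a i) by have [] := svalP (Qex a i).
have QA a j i : al a j i *m (Q a i)^T *m Q a i = al a j i.
  by have [_] := svalP (Qex a i).
have kex a i : {k : N i | opbound delta (Q a i *m (1%:M - (Y i k)^T *m Y i k))}.
  have [_ _ H] := YP i; exact: cid (H _ (fQ a i)).
pose code a : {dffun forall i, N i} := [ffun i => sval (kex a i)].
have te1 : 1 <= 2 * (d%:R * t) / eps.
  rewrite ler_pdivlMr // mul1r; apply: le_trans et _.
  by rewrite ler_pM2l // ler_peMl // ltW.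
have H2 : 0 <= 34 * r%:R ^+ d * t / (eps / 2).
  by rewrite !mulr_ge0 ?exprn_ge0 ?invr_ge0 ?mulr_ge0 // ltW.
have fib c : #|[pred a | code a == c]|%:R <=
    (34 * r%:R ^+ d * t / (eps / 2)) ^+ (d * (r * r)).
  pose Yc i := Y i (c i).
  have fYc i : frame (Yc i) by have [_ + _] := YP i; apply.
  pose b (a : A) j i := al a j i *m (Yc i)^T.
  pose T a := cp_tensor (fun j i => b a j i *m Yc i).
  have closeT a : code a = c ->
      frobenius (T a) <= frobenius (y a) /\
      frobenius (y a - T a) <= d%:R * (delta * frobenius (y a)).
    move=> ac.
    have QY i : opbound delta (Q a i *m (1%:M - (Yc i)^T *m Yc i)).
      by rewrite /Yc -ac ffunE; exact: svalP (kex a i).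
    have := project_modes_close (Q a) Yc (al a) delta d n0 (ltW delta0)
      (fQ a) fYc QY (QA a) (leqnn d).
    rewrite /=.
    have -> : cp_tensor (project_modes (fun i => (Yc i)^T *m Yc i) d (al a)) = T a.
      apply: cp_tensor_ext => j i.
      by rewrite /project_modes ltn_ord mulmxA.
    by rewrite (yE a).
  rewrite -(card_sig [pred a | code a == c]).
  apply: (cp_core_packing Yc (fun a => b (val a))) => //.
  - by rewrite divr_gt0.
  - lra.
  - case=> a /= /eqP ac; have [Tle _] := closeT a ac.
    exact: le_trans Tle (yt a).
  - case=> a pa [a' pa'] aa'.
    have {}aa' : a != a' by exact: aa'.
    have [_ c1] := closeT a (eqP pa); have [_ c2] := closeT a' (eqP pa').
    have small x : frobenius (y x - T x) <= d%:R * (delta * frobenius (y x)) ->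
        frobenius (y x - T x) <= eps / 4.
      move/le_trans; apply; apply: (@le_trans _ _ (d%:R * (delta * t))).
        by rewrite ler_pM2l ?ltr0n // ler_pM2l.
      rewrite le_eqVlt; apply/orP; left; apply/eqP; rewrite /delta; field.
      by rewrite !gt_eqF // ltr0n.
    have {}c1 := small _ c1; have {}c2 := small _ c2.
    have := sep a a' aa'; rewrite /=.
    have -> : y a - y a' = (y a - T a) + ((T a - T a') + (T a' - y a')).
      by rewrite !addrA !subrK.
    have := frobeniusD (y a - T a) ((T a - T a') + (T a' - y a')).
    have := frobeniusD (T a - T a') (T a' - y a').
    rewrite (frobeniusBC (T a')) -/(T a) -/(T a').
    move: (frobenius (T a - T a')) => ? ? ? ?; lra.
have := card_le_fibers code _ fib => /le_trans; apply.
have -> : (476 * r%:R ^+ d * t / eps) ^+ (d * (r * r)) =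
    7 ^+ (d * (r * r)) * (34 * r%:R ^+ d * t / (eps / 2)) ^+ (d * (r * r)) :> R.
  by rewrite -exprMn; congr (_ ^+ _); field; rewrite gt_eqF.
rewrite mulrA ler_wpM2r ?exprn_ge0 //.
have cardN : #|{dffun forall i, N i}| = (\prod_i #|N i|)%N.
  by rewrite card_dep_ffun foldrE big_map big_enum.
rewrite cardN natr_prod.
have -> : (d * (r * r) = \sum_(i < d) r * r)%N by rewrite sum_nat_const card_ord.
rewrite !expr_sum -big_split /=; apply: ler_prod => i _.
rewrite ler0n /=; have [+ _ _] := YP i => /le_trans; apply.
have -> : (r * n i = r * (n i - r) + r * r)%N by rewrite -mulnDr subnK.
rewrite exprD mulrAC ler_wpM2r ?exprn_ge0 // -exprMn.
have d9 : 0 <= 9 / delta by rewrite divr_ge0 // ltW.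
apply: lerXn2r; rewrite ?nnegrE.
- by rewrite mulr_ge0 // addr_ge0.
- by rewrite !mulr_ge0 ?invr_ge0 // ltW.
- have -> : 9 / delta = 18 * (2 * (d%:R * t) / eps).
    by rewrite /delta; field; rewrite !gt_eqF // ltr0n.
  have -> : 266 * d%:R * t / eps = 133 * (2 * (d%:R * t) / eps).
    by field; rewrite gt_eqF.
  lra.
Qed.

(** * Covering numbers *)

Lemma lne_covering_number_le {R : realType} {d : nat} {n : 'I_d -> nat}
    (W : set (tensor R n)) (eps B : R) :
  0 <= eps -> 0 < B ->
  (forall (A : finType) (y : A -> tensor R n), (forall a, W (y a)) ->
     (forall a b, a != b -> eps < frobenius (y a - y b)) -> #|A|%:R <= B) ->
  (lne (covering_number W eps) <= (ln B)%:E)%E.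
Proof.
move=> eps0 B0 bnd.
have farC (x y : tensor R n) : eps < frobenius (x - y) -> eps < frobenius (y - x).
  by rewrite frobeniusBC.
have [M [y [Wy sep net]]] := maximal_packing W _ B farC bnd.
have MB : M%:R <= B by have := bnd _ y Wy sep; rewrite card_ord.
have cB : (covering_number W eps <= B%:E)%E.
  apply: (@le_trans _ _ (M%:R%:E)%E); last by rewrite lee_fin.
  apply: ereal_inf_lbound; exists M => //.
  pose f (k : nat) : tensor R n := if insub k is Some i then y i else 0.
  have fE (k : 'I_M) : f k = y k by rewrite /f valK.
  have f_inj : {in `I_M &, injective f}.
    move=> k l; rewrite !inE /= => kM lM.
    rewrite (fE (Ordinal kM)) (fE (Ordinal lM)) => E; apply/eqP/negP => /negP kl.
    have := sep (Ordinal kM) (Ordinal lM) kl; rewrite E subrr.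
    by rewrite -(scale0r (0 : tensor R n)) frobeniusZ normr0 mul0r ltNge eps0.
  exists (f @` `I_M); split; last exact: inj_card_eq.
  split=> [_ [k /= kM <-]|x Wx]; first by rewrite (fE (Ordinal kM)).
  have [i /negP] := net x Wx; rewrite -leNgt => xi.
  by exists (y i); split => //; exists (val i); rewrite ?fE /=.
case: (covering_number W eps) cB => [s| |] //= sB; last exact: leNye.
by case: (leP s 0) => [_|s0]; [rewrite leNye|rewrite lee_fin ler_ln ?posrE].
Qed.

Lemma cp_rank_leZ {R : realType} {d r : nat} {n : 'I_d -> nat} (a : R)
    (T : tensor R n) :
  (0 < d)%N -> cp_rank_le R n r T -> cp_rank_le R n r (a *: T).
Proof.
case: d n T => // d n T _ [v ->].
exists (fun j => eqtype.dfwith (v j) (v j ord0 *m a%:M)).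
rewrite -[LHS]/(a *: cp_tensor v) -[RHS]/(cp_tensor _) -modeop_cp.
rewrite modeop_sum scaler_sumr; apply: eq_bigr => j _.
rewrite modeop_outer; apply/ffunP => I.
rewrite !ffunE (bigD1 ord0) //= [RHS](bigD1 ord0) //= eqtype.dfwith_in.
rewrite mul_mx_scalar mxE -[RHS]mulrA; congr (a * (_ * _)).
by apply: eq_bigr => i i0; rewrite eqtype.dfwith_out // eq_sym.
Qed.

Lemma frobenius_eq0 {R : realType} {d : nat} {n : 'I_d -> nat} (T : tensor R n) :
  frobenius T = 0 -> T = 0.
Proof.
move=> T0; apply/ffunP => I; rewrite [RHS]ffunE; apply/eqP; rewrite -sqrf_eq0.
have : \sum_X (T : {ffun mindex n -> R}) X ^+ 2 = 0.
  by rewrite -sqr_enorm [enorm _]T0 expr0n.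
move/eqP; rewrite psumr_eq0 => [/allP/(_ I)|i _]; last exact: sqr_ge0.
by rewrite mem_index_enum => /(_ isT).
Qed.

(** The multiples rho_k u of a point u, with rho_k = 1 - k eps/2 >= 1/2, are eps/2 apart,
    and multiples of different points with the same k are more than eps/2 apart. *)
Lemma sphere_packing {R : realType} {d r : nat} {n : 'I_d -> nat} (eps B : R) :
  (0 < d)%N -> 0 < eps -> 
  (forall (A : finType) (y : A -> tensor R n), (forall a, cp_rank_le R n r (y a)) ->
     (forall a, frobenius (y a) <= 1) ->
     (forall a b, a != b -> eps / 4 < frobenius (y a - y b)) -> #|A|%:R <= B) ->
  forall (A : finType) (u : A -> tensor R n),
    (forall a, sphere_proj (cp_rank_le R n r) (u a)) ->
    (forall a b, a != b -> eps < frobenius (u a - u b)) -> #|A|%:R <= eps * B.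
Proof.
move=> d0 eps0 bnd A u Vu sep.
have u1 a : frobenius (u a) = 1.
  have [T [_ T0] <-] := Vu a; have : frobenius T != 0.
    by apply: contra_neq T0; exact: frobenius_eq0.
  move=> f0; rewrite frobeniusZ ger0_norm ?invr_ge0 ?frobenius_ge0 //.
  by rewrite mulVf.
have uV a : cp_rank_le R n r (u a).
  by have [T [VT _] <-] := Vu a; exact: cp_rank_leZ.
pose K := (Num.Def.truncn eps^-1).+1.
have eps'0 : 0 <= eps^-1 by rewrite invr_ge0 ltW.
have /andP[K1 K2] := truncn_itv eps'0; rewrite -/K in K2.
pose rho (k : 'I_K) : R := 1 - k%:R * (eps / 2).
have rho12 k : 2^-1 <= rho k <= 1.
  have kK : k%:R <= eps^-1 by apply: le_trans K1; rewrite ler_nat -ltnS.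
  have : k%:R * eps <= 1.
    by rewrite -ler_pdivlMr // div1r.
  have : 0 <= k%:R * eps by rewrite mulr_ge0 // ltW.
  rewrite /rho mulrA => ? ?; apply/andP; split; lra.
have rho0 k : 0 <= rho k by have /andP[h _] := rho12 k; apply: le_trans h.
have fr p : frobenius (rho p.2 *: u p.1) = rho p.2.
  by rewrite frobeniusZ u1 mulr1 ger0_norm.
have far (k l : 'I_K) a b : (k < l)%N -> eps / 4 < frobenius (rho k *: u a - rho l *: u b).
  move=> kl.
  have := frobeniusD (rho k *: u a - rho l *: u b) (rho l *: u b).
  rewrite subrK (fr (a, k)) (fr (b, l)) /=.
  have : k%:R + 1 <= l%:R :> R by rewrite natr1 ler_nat.
  rewrite /rho => kl1 h.
  have : eps / 2 <= (l%:R - k%:R) * (eps / 2).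
    by rewrite ler_peMl ?divr_ge0 // ?(ltW eps0) //; lra.
  lra.
have := bnd (A * 'I_K)%type (fun p => rho p.2 *: u p.1).
rewrite card_prod card_ord natrM => H.
have {H} : #|A|%:R * K%:R <= B.
  apply: H.
  - by move=> p; exact: cp_rank_leZ.
  - by move=> p; rewrite fr; have /andP[] := rho12 p.2.
  - case=> a k [b l] /= pq.
    have [kl|kl|/val_inj kl] := ltngtP k l.
    + exact: far.
    + by rewrite frobeniusBC; exact: far.
    + rewrite -kl -scalerBr frobeniusZ ger0_norm //.
      have ab : a != b by apply: contra pq => /eqP ->; rewrite kl.
      have := sep a b ab; have /andP[] := rho12 k.
      move: (rho k) (frobenius _) => x f x1 _ f1.
      apply: (@lt_le_trans _ _ (2^-1 * f)); first lra.
      by rewrite ler_wpM2r //; lra.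
rewrite -ler_pdivlMr ?ltr0n // => /le_trans; apply.
have B0 : 0 <= B.
  have := bnd void (fun v => match v with end).
  by rewrite card_void; apply; case.
rewrite mulrC ler_wpM2r // -[eps]invrK lef_pV2 ?posrE ?ltr0n ?invr_gt0 //.
exact: ltW.
Qed.

Lemma mem_scaled_ball {R : realType} {d : nat} {n : 'I_d -> nat} (t : R)
    (T : tensor R n) :
  0 < t -> [set (t *: T)%R | T in unit_ball R n] T -> frobenius T <= t.
Proof.
move=> t0 [S S1 <-]; rewrite frobeniusZ gtr0_norm //.
by rewrite -[X in _ <= X]mulr1 ler_pM2l.
Qed.

Lemma ln_nat_pow2 {R : realType} (m k : nat) :
  (0 < m)%N -> (m <= 2 ^ k)%N -> ln (m%:R : R) <= k%:R * ln 2.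
Proof.
move=> m0 mk; rewrite mulr_natl -lnXn // ler_ln ?posrE ?ltr0n ?exprn_gt0 //.
by rewrite -natrX ler_nat.
Qed.

Lemma mul_avg_dim {R : realType} {d : nat} (n : 'I_d -> nat) (r : nat) :
  (0 < d)%N -> r%:R * d%:R * avg_dim R n = (r * \sum_i n i)%N%:R :> R.
Proof.
move=> d0; rewrite /avg_dim natrM natr_sum; field.
by rewrite pnatr_eq0 -lt0n.
Qed.

Lemma ln_prod_nat {R : realType} {d : nat} (n : 'I_d -> nat) :
  (forall i, 0 < n i)%N -> ln ((\prod_i n i)%N%:R : R) = \sum_i ln (n i)%:R.
Proof.
move=> n0; rewrite natr_prod.
suff [_ ->] : 0 < \prod_i (n i)%:R :> R /\
    ln (\prod_i (n i)%:R : R) = \sum_i ln (n i)%:R by [].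
elim/big_rec2: _ => [|i s p _ [p0 <-]]; first by rewrite ln1.
have ni0 : 0 < (n i)%:R :> R by rewrite ltr0n.
by rewrite mulr_gt0 // lnM.
Qed.

Lemma mulXn_gt0 {R : realType} (a b x : R) (k : nat) :
  0 < a -> 0 < b -> 0 < x -> 0 < (a * b * x) ^+ k.
Proof. by move=> a0 b0 x0; rewrite exprn_gt0 ?mulr_gt0. Qed.

Lemma ln_mul3 {R : realType} (a b x : R) :
  0 < a -> 0 < b -> 0 < x -> ln (a * b * x) = ln a + ln b + ln x.
Proof. by move=> a0 b0 x0; rewrite !lnM ?posrE ?mulr_gt0. Qed.

Lemma ln_mulXn {R : realType} (a b x : R) (k : nat) :
  0 < a -> 0 < b -> 0 < x ->
  ln ((a * b * x) ^+ k) = k%:R * (ln a + ln b + ln x).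
Proof.
by move=> a0 b0 x0; rewrite lnXn ?mulr_gt0 // ln_mul3 // mulr_natl.
Qed.

Lemma dim_split {d : nat} (n : 'I_d -> nat) (r : nat) :
  (forall i, r <= n i)%N ->
  (r * \sum_i n i = \sum_i r * (n i - r) + d * (r * r))%N.
Proof.
move=> rn; rewrite big_distrr /=.
have -> : (d * (r * r) = \sum_(i < d) r * r)%N by rewrite sum_nat_const card_ord.
by rewrite -big_split; apply: eq_bigr => i _; rewrite /= -mulnDr subnK.
Qed.

(** The slack in the bound for r <= n_i. Here Delta = sum_i r (n_i - r), l2 = log 2,
    44 l2 = log c1 and 100 = c2. The constants raised to the power d r^2
    are absorbed by the term in lr = log r if r >= 2; if r = 1 that term vanishes, but
    Delta >= d. *)
Lemma tucker_log_ball {R : realType} (d r Delta L1 L2 lr ld l2 : R) :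
  1 <= d -> 1 <= r -> 0 <= Delta -> 0 < l2 -> 0 <= ld ->
  (r = 1 /\ d <= Delta /\ lr = 0) \/ l2 <= lr ->
  L1 <= 9 * l2 -> L2 <= 9 * l2 ->
  Delta * L1 + d * (r * r) * (L2 + d * lr) <=
    Delta * (44 * l2) + d * (r * r) * ld + 100 * d ^+ 2 * r ^+ 2 * lr.
Proof.
move=> d1 r1 D0 l20 ld0 cases h1 h2.
have dr0 : 0 <= d * (r * r) by rewrite !mulr_ge0 //; lra.
have e1 : Delta * L1 <= Delta * (9 * l2) by rewrite ler_wpM2l.
have e2 : d * (r * r) * L2 <= d * (r * r) * (9 * l2) by rewrite ler_wpM2l.
have e3 : 0 <= d * (r * r) * ld by rewrite mulr_ge0.
have Dl : 0 <= Delta * l2 by rewrite mulr_ge0 // ltW.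
case: cases => [[rE [dD lr0]]|lr2].
  have e4 : d * l2 <= Delta * l2 by rewrite ler_wpM2r // ltW.
  rewrite rE lr0 in e2 e3 *; lra.
have e0 : 0 <= d * (r * r) * l2 by rewrite mulr_ge0 // ltW.
have e4 : d * (r * r) * l2 <= d * (r * r) * lr by rewrite ler_wpM2l.
have e5 : d * (r * r) * lr <= d * (d * (r * r) * lr).
  by rewrite ler_peMl // mulr_ge0 //; lra.
have -> : 100 * d ^+ 2 * r ^+ 2 * lr = 100 * (d * (d * (r * r) * lr)) by ring.
have -> : d * (r * r) * (L2 + d * lr) =
  d * (r * r) * L2 + d * (d * (r * r) * lr) by ring.
lra.
Qed.

(** As for the ball, with one power of c1 less; for r = 1 this requires
    Delta >= 2. *)
Lemma tucker_log_sphere {R : realType} (d r Delta L1 L2 lr ld l2 : R) :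
  1 <= d -> 1 <= r -> 0 <= Delta -> 0 < l2 -> 0 <= ld ->
  (r = 1 /\ d <= Delta /\ 2 <= Delta /\ lr = 0) \/ l2 <= lr ->
  L1 <= 11 * l2 -> L2 <= 11 * l2 ->
  Delta * L1 + d * (r * r) * (L2 + d * lr) <=
    (Delta - 1) * (44 * l2) + (d * (r * r) - 1) * ld +
    100 * d ^+ 2 * r ^+ 2 * lr.
Proof.
move=> d1 r1 D0 l20 ld0 cases h1 h2.
have dr1 : 1 <= d * (r * r) by rewrite mulr_ege1 // mulr_ege1.
have e1 : Delta * L1 <= Delta * (11 * l2) by rewrite ler_wpM2l.
have e2 : d * (r * r) * L2 <= d * (r * r) * (11 * l2) by rewrite ler_wpM2l //; lra.
have e3 : 0 <= (d * (r * r) - 1) * ld by rewrite mulr_ge0 //; lra.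
have Dl : 0 <= Delta * l2 by rewrite mulr_ge0 // ltW.
case: cases => [[rE [dD [D2 lr0]]]|lr2].
  have e4 : d * l2 <= Delta * l2 by rewrite ler_wpM2r // ltW.
  have e5 : 2 * l2 <= Delta * l2 by rewrite ler_wpM2r // ltW.
  rewrite rE lr0 in e2 e3 *; lra.
have e4 : d * (r * r) * l2 <= d * (r * r) * lr by rewrite ler_wpM2l //; lra.
have e6 : l2 <= d * (r * r) * l2 by rewrite ler_peMl // ltW.
have e5 : d * (r * r) * lr <= d * (d * (r * r) * lr).
  by rewrite ler_peMl // mulr_ge0 //; lra.
have -> : 100 * d ^+ 2 * r ^+ 2 * lr = 100 * (d * (d * (r * r) * lr)) by ring.
have -> : d * (r * r) * (L2 + d * lr) =
  d * (r * r) * L2 + d * (d * (r * r) * lr) by ring.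
lra.
Qed.

(* The hypothesis 2 < r * (n_1 + ... + n_d) of the last bound excludes only
   d = 1, r = 1, n_1 = 2. There sphere_proj V is the unit circle of R^2 and the
   bound would read log N <= log (1 / eps), which fails at eps = 2. *)
Theorem theorem3p1 (R : realType) :
  exists c c1 c2 : R,
    0 < c /\ 1 <= c1 /\ 1 <= c2 /\
    forall (d r : nat) (n : 'I_d -> nat),
      (0 < d)%N -> (0 < r)%N -> (forall i, (2 <= n i)%N) ->
      let V := cp_rank_le R n r in
      let D := r%:R * d%:R * avg_dim R n in
      (forall t eps : R, 0 < t -> 0 < eps -> eps <= 2 * t ->
         (lne (covering_number
                 (V `&` [set (t *: T)%R | T in unit_ball R n]) eps)
          <= (D * ln (t / eps) + c * D * \sum_(i < d) ln (n i)%:R)%:E)%E) /\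
      ((forall i, (r <= n i)%N) ->
       forall t eps : R, 0 < t -> 0 < eps -> eps <= 2 * t ->
         (lne (covering_number
                 (V `&` [set (t *: T)%R | T in unit_ball R n]) eps)
          <= (D * ln (c1 * d%:R * t / eps)
              + c2 * d%:R ^+ 2 * r%:R ^+ 2 * ln r%:R
              - d%:R * r%:R ^+ 2 * ln c1)%:E)%E) /\
      (forall eps : R, 0 < eps -> eps <= 2 ->
         (lne (covering_number (sphere_proj V) eps)
          <= ((D - 1) * ln (1 / eps)
              + c * (D - 1) * \sum_(i < d) ln (n i)%:R)%:E)%E) /\
      ((forall i, (r <= n i)%N) -> (2 < r * \sum_(i < d) n i)%N ->
       forall eps : R, 0 < eps -> eps <= 2 ->
         (lne (covering_number (sphere_proj V) eps)
          <= ((D - 1) * ln (c1 * d%:R * 1 / eps)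
              + c2 * d%:R ^+ 2 * r%:R ^+ 2 * ln r%:R
              - d%:R * r%:R ^+ 2 * ln c1)%:E)%E).
Proof.
have l2 : 0 < ln (2 : R) by rewrite ln_gt0 // ltr1n.
have lnc1 : ln (2 ^+ 44 : R) = 44 * ln 2 by rewrite lnXn // mulr_natl.
have c10 : 0 < (2 : R) ^+ 44 by rewrite exprn_gt0.
have p44 : 1 <= (2 : R) ^+ 44 by rewrite exprn_ege1 // ler1n.
exists 18, (2 ^+ 44), 100; do 3!(split; first by [lra|done]).
move=> d r n d0 r0 n2 V D.
have n0 i : (0 < n i)%N by exact: leq_trans (n2 i).
set N := (\prod_i n i)%N; set S := \sum_i ln (n i)%:R.
have N0 : (0 < N)%N by exact: prodn_gt0.
have N0R : 0 < N%:R :> R by rewrite ltr0n.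
have lnN : ln (N%:R : R) = S by exact: ln_prod_nat.
have d0R : 0 < d%:R :> R by rewrite ltr0n.
have r0R : 0 < r%:R :> R by rewrite ltr0n.
have d1R : 1 <= d%:R :> R by rewrite ler1n.
have r1R : 1 <= r%:R :> R by rewrite ler1n.
pose k := (r * \sum_i n i)%N.
have DE : D = k%:R by exact: mul_avg_dim.
have rd0R : 0 < r%:R ^+ d :> R by rewrite exprn_gt0.
have pos (m : nat) : (0 < m)%N -> 0 < m%:R :> R by rewrite ltr0n.
have sum2 : (2 * d <= \sum_i n i)%N.
  rewrite mulnC -[d in (d * 2)%N]card_ord -sum_nat_const.
  by apply: leq_sum => i _.
have k2 : (2 <= k)%N.
  by apply: leq_trans (leq_pmull _ r0); apply: leq_trans sum2; rewrite leq_pmulr.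
have k2R : 2 <= k%:R :> R by rewrite ler_nat.
have S2 : ln 2 <= S.
  rewrite /S (bigD1 (Ordinal d0)) //=; apply: ler_wpDr.
    by apply: sumr_ge0 => i _; rewrite ln_ge0 // ler1n.
  by rewrite ler_ln ?posrE ?ltr0n // ler_nat.
have lnd0 : 0 <= ln (d%:R : R) by rewrite ln_ge0.
have ball_le t T : 0 < t -> (V `&` [set (t *: T)%R | T in unit_ball R n]) T ->
    cp_rank_le R n r T /\ frobenius T <= t.
  by move=> t0 [VT bT]; split=> //; exact: mem_scaled_ball.
pose Delta := (\sum_i r * (n i - r))%N.
have kDelta : (forall i, r <= n i)%N -> k%:R = Delta%:R + d%:R * (r%:R * r%:R) :> R.
  by move=> rn; rewrite /k (dim_split n r rn) natrD !natrM.
have Delta1 : r = 1%N -> (d <= Delta)%N.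
  move=> r1; rewrite /Delta -[d in (d <= _)%N]card_ord -sum1_card.
  by apply: leq_sum => i _; rewrite r1 mul1n subn_gt0.
have lnr2 : r != 1%N -> ln 2 <= ln (r%:R : R).
  move=> r1; rewrite ler_ln ?posrE // ler_nat.
  by rewrite ltn_neqAle eq_sym r1.
split; [|split; [|split]].
- move=> t eps t0 eps0 et.
  have x0 : 0 < t / eps by rewrite divr_gt0.
  apply: le_trans (lne_covering_number_le _ _ ((34 * N%:R * (t / eps)) ^+ k) _ _ _) _.
  + exact: ltW.
  + exact: (mulXn_gt0 _ _ _ _ (pos 34 isT) N0R x0).
  + move=> A y yW sep; rewrite mulrA.
    apply: (cp_ball_packing y) => // a; by have [] := ball_le t (y a) t0 (yW a).
  rewrite lee_fin (ln_mulXn _ _ _ _ (pos 34 isT) N0R x0) lnN DE.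
  have h : ln (34 : R) <= 6 * ln 2 by exact: ln_nat_pow2.
  have : k%:R * ln (34 : R) <= k%:R * (6 * S).
    by rewrite ler_wpM2l //; lra.
  have : 0 <= k%:R * S by rewrite mulr_ge0 //; lra.
  lra.
- move=> rn t eps t0 eps0 et.
  have x0 : 0 < t / eps by rewrite divr_gt0.
  have X1 := mulXn_gt0 _ _ _ Delta (pos 266 isT) d0R x0.
  have X2 := mulXn_gt0 _ _ _ (d * (r * r)) (pos 476 isT) rd0R x0.
  apply: le_trans (lne_covering_number_le _ _
     ((266 * d%:R * (t / eps)) ^+ Delta *
      (476 * r%:R ^+ d * (t / eps)) ^+ (d * (r * r))) _ _ _) _.
  + exact: ltW.
  + exact: mulr_gt0 X1 X2.
  + move=> A y yW sep; rewrite !(mulrA _ t).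
    apply: (cp_ball_packing_tucker y) => // a; by have [] := ball_le t (y a) t0 (yW a).
  rewrite lee_fin.
  rewrite (lnM X1 X2) (ln_mulXn _ _ _ _ (pos 266 isT) d0R x0).
  rewrite (ln_mulXn _ _ _ _ (pos 476 isT) rd0R x0) (lnXn d) // -(mulr_natl (ln r%:R)).
  rewrite -(mulrA (2 ^+ 44 * _)) (ln_mul3 _ _ _ c10 d0R x0) lnc1 DE kDelta // !natrM.
  have := @tucker_log_ball R d%:R r%:R Delta%:R (ln 266) (ln 476)
    (ln r%:R) (ln d%:R) (ln 2) d1R r1R (ler0n _ _) l2 lnd0 _
    (ln_nat_pow2 266 9 isT isT) (ln_nat_pow2 476 9 isT isT).
  have cs : (r%:R = 1 :> R /\ d%:R <= Delta%:R :> R /\ ln r%:R = 0 :> R) \/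
      ln 2 <= ln (r%:R : R).
    have [r1|r1] := eqVneq r 1%N; last by right; exact: lnr2.
    by left; rewrite ler_nat Delta1 // r1 ln1.
  move=> /(_ cs); rewrite [r%:R ^+ 2]expr2; lra.
- move=> eps eps0 e2.
  have x0 : 0 < 1 / eps by rewrite divr_gt0.
  have lx : ln eps = - ln (1 / eps) by rewrite div1r lnV ?opprK ?posrE.
  apply: le_trans (lne_covering_number_le _ _
    (eps * (136 * N%:R * (1 / eps)) ^+ k) _ _ _) _.
  + exact: ltW.
  + exact: mulr_gt0 eps0 (mulXn_gt0 _ _ _ _ (pos 136 isT) N0R x0).
  + apply: (@sphere_packing _ _ r) => // A y yV y1 sep.
    have -> : 136 * N%:R * (1 / eps) = 34 * N%:R * 1 / (eps / 4).
      by field; rewrite gt_eqF.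
    by apply: (cp_ball_packing y) => //; lra.
  rewrite lee_fin lnM; [|exact: eps0|exact: (mulXn_gt0 _ _ _ _ (pos 136 isT) N0R x0)].
  rewrite (ln_mulXn _ _ _ _ (pos 136 isT) N0R x0) lnN DE lx.
  (* 136 <= 2^8 <= exp (8 S) and k <= 2 (k - 1) make 18 S (k - 1) enough *)
  have h : ln (136 : R) <= 8 * ln 2 by exact: ln_nat_pow2.
  have : k%:R * ln (136 : R) <= k%:R * (8 * S).
    by rewrite ler_wpM2l //; lra.
  have : 2 * S <= k%:R * S by rewrite ler_wpM2r //; lra.
  lra.
- move=> rn k3 eps eps0 e2.
  have x0 : 0 < 1 / eps by rewrite divr_gt0.
  have lx : ln eps = - ln (1 / eps) by rewrite div1r lnV ?opprK ?posrE.
  have X1 := mulXn_gt0 _ _ _ Delta (pos 1064 isT) d0R x0.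
  have X2 := mulXn_gt0 _ _ _ (d * (r * r)) (pos 1904 isT) rd0R x0.
  apply: le_trans (lne_covering_number_le _ _
     (eps * ((1064 * d%:R * (1 / eps)) ^+ Delta *
      (1904 * r%:R ^+ d * (1 / eps)) ^+ (d * (r * r)))) _ _ _) _.
  + exact: ltW.
  + exact: mulr_gt0 eps0 (mulr_gt0 X1 X2).
  + apply: (@sphere_packing _ _ r) => // A y yV y1 sep.
    have -> : 1064 * d%:R * (1 / eps) = 266 * d%:R * 1 / (eps / 4).
      by field; rewrite gt_eqF.
    have -> : 1904 * r%:R ^+ d * (1 / eps) = 476 * r%:R ^+ d * 1 / (eps / 4).
      by field; rewrite gt_eqF.
    by apply: (cp_ball_packing_tucker y) => //; lra.
  rewrite lee_fin (lnM eps0 (mulr_gt0 X1 X2)).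
  rewrite (lnM X1 X2) (ln_mulXn _ _ _ _ (pos 1064 isT) d0R x0).
  rewrite (ln_mulXn _ _ _ _ (pos 1904 isT) rd0R x0) (lnXn d) // -(mulr_natl (ln r%:R)) lx.
  rewrite -(mulrA (2 ^+ 44 * _)) (ln_mul3 _ _ _ c10 d0R x0) lnc1 DE kDelta // !natrM.
  have := @tucker_log_sphere R d%:R r%:R Delta%:R (ln 1064) (ln 1904)
    (ln r%:R) (ln d%:R) (ln 2) d1R r1R (ler0n _ _) l2 lnd0 _
    (ln_nat_pow2 1064 11 isT isT) (ln_nat_pow2 1904 11 isT isT).
  have cs : (r%:R = 1 :> R /\ d%:R <= Delta%:R :> R /\ 2 <= Delta%:R :> R /\
        ln r%:R = 0 :> R) \/ ln 2 <= ln (r%:R : R).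
    have [r1|r1] := eqVneq r 1%N; last by right; exact: lnr2.
    left; rewrite !ler_nat Delta1 // r1 ln1; split => //; split => //; split => //.
    (* k = Delta + d, d <= Delta and k >= 3 *)
    have k2D : (k <= Delta + Delta)%N.
      rewrite /k (dim_split n r rn) -/Delta leq_add2l r1 !muln1.
      exact: Delta1.
    by have := leq_trans k3 k2D; case: (Delta) => [|[|D']].
  move=> /(_ cs); rewrite [r%:R ^+ 2]expr2; lra.
Qed.
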